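(* Let $E_0<E_1$, and let $(\overline C,\langle\cdot,\cdot\rangle,\{\mathfrak m^i_{k,\beta}\})$, $i=0,1$, be $G$-gapped cyclic filtered $A_\infty$ algebras modulo $T^{E_i}$ on the same graded real vector space with pairing. Let $(C,\langle\cdot,\cdot\rangle,\{\mathfrak m^t_{k,\beta}\},\{\mathfrak c^t_{k,\beta}\})$ be a pseudo-isotopy modulo $T^{E_0}$ between them (i.e. $\mathfrak m^t_{k,\beta}=\mathfrak m^0_{k,\beta}$ at $t=0$ and $\mathfrak m^t_{k,\beta}=\mathfrak m^1_{k,\beta}$ at $t=1$ for $E(\beta)<E_0$). Then: 1. $(\overline C,\langle\cdot,\cdot\rangle,\{\mathfrak m^0_{k,\beta}\})$ can be extended to a $G$-gapped cyclic filtered $A_\infty$ algebra modulo $T^{E_1}$. 2. $(C,\langle\cdot,\cdot\rangle,\{\mathfrak m^t_{k,\beta}\},\{\mathfrak c^t_{k,\beta}\})$ can be extended to a pseudo-isotopy modulo $T^{E_1}$ between them (between the extension in 1 and $\{\mathfrak m^1_{k,\beta}\}$). The unital version also holds: if all the given data are unital with the same unit $\mathbf e$, the extensions can be taken unital with unit $\mathbf e$.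
   Context: $G\subset\mathbb R_{\ge0}\times2\mathbb Z$, with projections $E:G\to\mathbb R$, $\mu:G\to2\mathbb Z$, is a discrete submonoid: $(0,0)\in G$, $G$ is closed under addition, $E(G)$ is discrete, $G\cap E^{-1}(\lambda)$ is finite for each $\lambda$. For a graded real vector space $\overline C$ put $\deg'x=\deg x-1$; $\overline C[1]$ is $\overline C$ graded by $\deg'$; $B_k$ is the $k$-fold tensor power. A $G$-gapped cyclic filtered $A_\infty$ algebra $(\overline C,\langle\cdot,\cdot\rangle,\{\mathfrak m_{k,\beta}\})$ consists of a nondegenerate bilinear pairing $\langle\cdot,\cdot\rangle:\overline C^j\otimes\overline C^{n-j}\to\mathbb R$ ($n$ fixed) with $\langle x,y\rangle=(-1)^{1+\deg'x\deg'y}\langle y,x\rangle$ and linear maps $\mathfrak m_{k,\beta}:B_k(\overline C[1])\to\overline C[1]$ of degree $1-\mu(\beta)$, $k\ge0$, $\beta\in G$, such that (i) $\mathfrak m_{0,(0,0)}=0$; (ii) $\sum_{k_1+k_2=k+1}\sum_{\beta_1+\beta_2=\beta}\sum_{i=1}^{k-k_2+1}(-1)^{\deg'x_1+\cdots+\deg'x_{i-1}}\mathfrak m_{k_1,\beta_1}(x_1,\ldots,\mathfrak m_{k_2,\beta_2}(x_i,\ldots,x_{i+k_2-1}),\ldots,x_k)=0$ for all $k,\beta$; (iii) $\langle\mathfrak m_{k,\beta}(x_1,\ldots,x_k),x_0\rangle=(-1)^{\deg'x_0(\deg'x_1+\cdots+\deg'x_k)}\langle\mathfrak m_{k,\beta}(x_0,x_1,\ldots,x_{k-1}),x_k\rangle$;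 (iv) the pairing induced on the $\mathfrak m_{1,(0,0)}$-cohomology is perfect. ''Modulo $T^{E_0}$'' means that $\mathfrak m_{k,\beta}$ is given, and the relations are required, only for $E(\beta)<E_0$. Extending a structure modulo $T^{E_0}$ to one modulo $T^{E_1}$ means adding operations for $E_0\le E(\beta)<E_1$ without changing the given ones. A unit is $\mathbf e\in\overline C^0$ with $\mathfrak m_{2,(0,0)}(\mathbf e,x)=(-1)^{\deg x}\mathfrak m_{2,(0,0)}(x,\mathbf e)=x$ and $\mathfrak m_{k,\beta}(\ldots,\mathbf e,\ldots)=0$ for $(k,\beta)\ne(2,(0,0))$. $C^\infty([0,1],\overline C)$ is the set of finite sums $\sum a_i(t)\mathfrak e_i$ with $a_i\in C^\infty([0,1])$ and $\mathfrak e_i$ in a basis of $\overline C$. A pseudo-isotopy $(C,\langle\cdot,\cdot\rangle,\{\mathfrak m^t_{k,\beta}\},\{\mathfrak c^t_{k,\beta}\})$ consists of maps $\mathfrak m^t_{k,\beta},\mathfrak c^t_{k,\beta}:B_k(\overline C[1])\to\overline C[1]$, $t\in[0,1]$, of degree $1-\mu(\beta)$ and $-\mu(\beta)$, such that: (1) $t\mapsto\mathfrak m^t_{k,\beta}(x_1,\ldots,x_k)$ and $t\mapsto\mathfrak c^t_{k,\beta}(x_1,\ldots,x_k)$ are in $C^\infty([0,1],\overline C)$; (2) for each $t$, $(\overline C,\langle\cdot,\cdot\rangle,\{\mathfrak m^t_{k,\beta}\})$ is a $G$-gapped cyclic filtered $A_\infty$ algebra; (3) $\langle\mathfrak c^t_{k,\beta}(x_1,\ldots,x_k),x_0\rangle=(-1)^{\deg'x_0(\deg'x_1+\cdots+\deg'x_k)}\langle\mathfrak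 c^t_{k,\beta}(x_0,\ldots,x_{k-1}),x_k\rangle$; (4) with sums over $k_1+k_2=k+1$, $\beta_1+\beta_2=\beta$, $1\le i\le k-k_2+1$, $$\frac{d}{dt}\mathfrak m^t_{k,\beta}(x_1,\ldots,x_k)+\sum(-1)^{\deg'x_1+\cdots+\deg'x_{i-1}}\mathfrak c^t_{k_1,\beta_1}(x_1,\ldots,\mathfrak m^t_{k_2,\beta_2}(x_i,\ldots),\ldots,x_k)-\sum\mathfrak m^t_{k_1,\beta_1}(x_1,\ldots,\mathfrak c^t_{k_2,\beta_2}(x_i,\ldots),\ldots,x_k)=0;$$ (5) $\mathfrak m^t_{k,(0,0)}$ is independent of $t$ and $\mathfrak c^t_{k,(0,0)}=0$. Modulo $T^{E_0}$: everything only for $E(\beta)<E_0$. It is unital with unit $\mathbf e$ if $\mathbf e$ is a unit of $\{\mathfrak m^t_{k,\beta}\}$ for each $t$ and $\mathfrak c^t_{k,\beta}(\ldots,\mathbf e,\ldots)=0$ for all $k,\beta,t$. *)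

(* Defs.v *)
From HB Require Import structures.
From mathcomp Require Import all_boot all_order all_algebra.
From mathcomp Require Import all_classical all_reals all_analysis.
Set Implicit Arguments.
Unset Strict Implicit.
Unset Printing Implicit Defensive.
Import Order.TTheory GRing.Theory Num.Theory.
Import numFieldNormedType.Exports.
Local Open Scope classical_set_scope.
Local Open Scope ring_scope.

(* Elements of G are pairs beta = (E(beta), mu(beta)). "E(G) is discrete" is
   read in the weak sense: every point of E(G) is isolated in E(G); local
   finiteness of E(G) is not assumed. *)
Record discrete_submonoid (R : realType) (G : set (R * int)) : Prop := {
  dsm_zero : G 0;
  dsm_add : forall b1 b2, G b1 -> G b2 -> G (b1 + b2);
  dsm_energy_ge0 : forall b, G b -> 0 <= b.1;
  dsm_maslov_even : forall b, G b -> (2%:Z %| b.2)%Z;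
  dsm_discrete : fst @` G `<=` isolated (fst @` G);
  dsm_fiber_finite : forall l : R, finite_set [set b | G b /\ b.1 = l]
}.

(* Z-graded real vector spaces, of arbitrary dimension: gr_space is the
   internal direct sum of the subspaces gr_part j. *)
Record gradedSpace (R : realType) : Type := GradedSpace {
  gr_space :> lmodType R;
  gr_part : int -> set gr_space;
  gr_zero : forall j, gr_part j 0;
  gr_lin : forall j (a : R) x y,
    gr_part j x -> gr_part j y -> gr_part j (a *: x + y);
  gr_span : forall x, exists (s : seq int) (f : int -> gr_space),
    (forall j, gr_part j (f j)) /\ x = \sum_(j <- s) f j;
  gr_direct : forall (s : seq int) (f : int -> gr_space), uniq s ->
    (forall j, gr_part j (f j)) -> \sum_(j <- s) f j = 0 ->
    forall j, j \in s -> f j = 0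
}.

(* x has deg' x = j, i.e. deg x = j + 1. *)
Definition shifted (R : realType) (C : gradedSpace R) (j : int) : set C :=
  @gr_part R C (j + 1).
Arguments shifted {R} C j.

(* ds is the list of shifted degrees deg' of the entries of xs. *)
Definition has_degs (R : realType) (C : gradedSpace R)
    (ds : seq int) (xs : seq C) : Prop :=
  size ds = size xs /\
  forall i, (i < size xs)%N -> shifted C (nth 0 ds i) (nth 0 xs i).

(* A bilinear pairing C^j (x) C^(n-j) -> R for all j, extended by zero to the
   other bidegrees. *)
Record cyclic_pairing (R : realType) (C : gradedSpace R) (n : int)
    (pair : C -> C -> R) : Prop := {
  pair_linear_r : forall x, scalar (fun y => pair x y);
  pair_linear_l : forall y, scalar (fun x => pair x y);
  pair_degree : forall i j x y,
    gr_part i x -> gr_part j y -> i + j <> n -> pair x y = 0;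
  pair_nondeg_l : forall j x, gr_part j x ->
    (forall y, gr_part (n - j) y -> pair x y = 0) -> x = 0;
  pair_nondeg_r : forall j y, gr_part (n - j) y ->
    (forall x, gr_part j x -> pair x y = 0) -> y = 0;
  pair_sym : forall i j x y, shifted C i x -> shifted C j y ->
    pair x y = (-1) ^ (1 + i * j) * pair y x
}.

(* A family of operations {m_{k,beta}}_{k,beta} is encoded as one function
   m : operations C, with m_{k,beta}(x_1,...,x_k) = m beta [:: x_1; ...; x_k];
   the arity k is the length of the list, and m_{0,beta}(1) = m beta [::].
   The values at beta outside G, or with E(beta) >= E0 when working modulo
   T^E0, are meaningless: nothing below constrains or uses them. *)
Definition operations (R : realType) (C : gradedSpace R) : Type :=
  R * int -> seq C -> C.

Definition multilinear_op (R : realType) (C : gradedSpace R)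
    (f : seq C -> C) : Prop :=
  forall xs ys, linear (fun x => f (xs ++ x :: ys)).

Definition has_degree (R : realType) (C : gradedSpace R)
    (f : seq C -> C) (r : int) : Prop :=
  forall ds xs, has_degs ds xs -> shifted C ((\sum_(d <- ds) d) + r) (f xs).

(* The case k = 0 of cyclic symmetry is a tautology; for k >= 1 the inputs
   x_1, ..., x_k are written rcons xs y. *)
Definition cyclic_symmetric (R : realType) (C : gradedSpace R)
    (pair : C -> C -> R) (f : seq C -> C) : Prop :=
  forall d0 x0 ds xs dk xk,
    shifted C d0 x0 -> has_degs ds xs -> shifted C dk xk ->
    pair (f (rcons xs xk)) x0 =
    (-1) ^ (d0 * ((\sum_(d <- ds) d) + dk)) * pair (f (x0 :: xs)) xk.

(* The pairs (beta1, beta2) in G x G with beta1 + beta2 = beta; this set is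
   finite when G is a discrete submonoid. *)
Definition decompositions (R : realType) (G : set (R * int)) (b : R * int) :
    set ((R * int) * (R * int)) :=
  [set p | [/\ G p.1, G p.2 & p.1 + p.2 = b]].

(* f_{k1,b1}(x_1, ..., g_{k2,b2}(x_i, ..., x_(i+k2-1)), ..., x_k), weighted
   by eps and summed over k1 + k2 = k + 1, b1 + b2 = b, 1 <= i <= k - k2 + 1.
   The index i used here is the paper's i - 1, and k2 = k + 1 is omitted since
   its range of i is empty. *)
Definition insertion_sum (R : realType) (C : gradedSpace R)
    (G : set (R * int)) (eps : nat -> R) (f g : operations C)
    (b : R * int) (xs : seq C) : C :=
  \sum_(p \in decompositions G b)
    \sum_(k2 < (size xs).+1) \sum_(i < (size xs - k2).+1)
      eps i *: f p.1 (take i xs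
                      ++ g p.2 (take k2 (drop i xs)) :: drop (i + k2) xs).

(* (-1)^(deg' x_1 + ... + deg' x_i) *)
Definition koszul (R : realType) (ds : seq int) (i : nat) : R :=
  (-1) ^ (\sum_(d <- take i ds) d).

Definition cocycles (R : realType) (C : gradedSpace R) (d : C -> C)
    (j : int) : set C := [set x | gr_part j x /\ d x = 0].

Definition coboundaries (R : realType) (C : gradedSpace R) (d : C -> C)
    (j : int) : set C := d @` gr_part (j - 1).

(* A linear functional on Z / B: a functional on Z vanishing on B. *)
Definition quotient_functional (R : realType) (C : gradedSpace R)
    (Z B : set C) (phi : C -> R) : Prop :=
  (forall (a : R) x y, Z x -> Z y -> phi (a *: x + y) = a * phi x + phi y) /\
  (forall x, B x -> phi x = 0).

(* The induced maps H^j -> (H^(n-j))^* and H^(n-j) -> (H^j)^* are bijective,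
   where H^j = cocycles d j / coboundaries d j. *)
Definition perfect_on_cohomology (R : realType) (C : gradedSpace R) (n : int)
    (pair : C -> C -> R) (d : C -> C) : Prop :=
  forall j,
  let Z := cocycles d j in let B := coboundaries d j in
  let Z' := cocycles d (n - j) in let B' := coboundaries d (n - j) in
  [/\ forall x, Z x -> (forall y, Z' y -> pair x y = 0) -> B x,
      forall phi, quotient_functional Z' B' phi ->
        exists2 x, Z x & forall y, Z' y -> pair x y = phi y,
      forall y, Z' y -> (forall x, Z x -> pair x y = 0) -> B' y &
      forall phi, quotient_functional Z B phi ->
        exists2 y, Z' y & forall x, Z x -> pair x y = phi x].

(* G-gapped cyclic filtered A_infinity algebra modulo T^E0. The conditions on
   m_{k,(0,0)} alone are required only if 0 = E(0,0) < E0. *)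
Record cyclic_Ainfty_mod (R : realType) (G : set (R * int))
    (C : gradedSpace R) (n : int) (pair : C -> C -> R) (E0 : R)
    (m : operations C) : Prop := {
  ainf_pairing : cyclic_pairing n pair;
  ainf_multilinear : forall b, G b -> b.1 < E0 -> multilinear_op (m b);
  ainf_degree : forall b, G b -> b.1 < E0 -> has_degree (m b) (1 - b.2);
  ainf_m0 : 0 < E0 -> m 0 [::] = 0;
  ainf_relation : forall b, G b -> b.1 < E0 ->
    forall ds xs, has_degs ds xs ->
      insertion_sum G (koszul R ds) m m b xs = 0;
  ainf_cyclic : forall b, G b -> b.1 < E0 -> cyclic_symmetric pair (m b);
  ainf_perfect : 0 < E0 ->
    perfect_on_cohomology n pair (fun x => m 0 [:: x])
}.

Record is_unit_mod (R : realType) (G : set (R * int)) (C : gradedSpace R)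
    (E0 : R) (m : operations C) (e : C) : Prop := {
  unit_deg : gr_part 0 e;
  unit_m2 : 0 < E0 -> forall d x, gr_part d x ->
    m 0 [:: e; x] = x /\ (-1) ^ d *: m 0 [:: x; e] = x;
  unit_vanish : forall b, G b -> b.1 < E0 -> forall xs ys,
    ~ (size (xs ++ e :: ys) = 2%N /\ b = 0) -> m b (xs ++ e :: ys) = 0
}.

(* m' extends m, which is given modulo T^E0. *)
Definition extends_mod (R : realType) (G : set (R * int))
    (C : gradedSpace R) (E0 : R) (m m' : operations C) : Prop :=
  forall b, G b -> b.1 < E0 -> forall xs, m' b xs = m b xs.

Definition smooth (R : realType) (f : R -> R) : Prop :=
  forall (n : nat) (t : R), derivable (derive1n n f) t 1.

Definition free_family (R : realType) (V : lmodType R) (k : nat)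
    (e : 'I_k -> V) : Prop :=
  forall c : 'I_k -> R, \sum_(i < k) c i *: e i = 0 -> forall i, c i = 0.

(* On [0,1], f(t) = sum_i a_i(t) e_i. A finite family is contained in a basis
   iff it is linearly independent, and an element of C^oo([0,1]) is the
   restriction to [0,1] of a smooth function a_i on the real line. *)
Definition path_expansion (R : realType) (V : lmodType R) (f : R -> V)
    (k : nat) (e : 'I_k -> V) (a : 'I_k -> R -> R) : Prop :=
  [/\ free_family e, forall i, smooth (a i) &
      forall t, t \in `[0, 1] -> f t = \sum_(i < k) a i t *: e i].

(* f belongs to C^oo([0,1], V). *)
Definition smooth_path (R : realType) (V : lmodType R) (f : R -> V) : Prop :=
  exists k (e : 'I_k -> V) (a : 'I_k -> R -> R), path_expansion f e a.

(* g = df/dt on [0,1], one-sided at the end points. *)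
Definition path_derivative (R : realType) (V : lmodType R)
    (f g : R -> V) : Prop :=
  exists k (e : 'I_k -> V) (a : 'I_k -> R -> R), path_expansion f e a /\
    forall t, t \in `[0, 1] -> g t = \sum_(i < k) derive1 (a i) t *: e i.

(* Pseudo-isotopy modulo T^E0; mt t and ct t are meaningful for t in [0,1]
   only. *)
Record pseudo_isotopy_mod (R : realType) (G : set (R * int))
    (C : gradedSpace R) (n : int) (pair : C -> C -> R) (E0 : R)
    (mt ct : R -> operations C) : Prop := {
  pi_c_multilinear : forall t, t \in `[0, 1] -> forall b, G b -> b.1 < E0 ->
    multilinear_op (ct t b);
  pi_c_degree : forall t, t \in `[0, 1] -> forall b, G b -> b.1 < E0 ->
    has_degree (ct t b) (- b.2);
  pi_m_smooth : forall b, G b -> b.1 < E0 -> forall xs,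
    smooth_path (fun t => mt t b xs);
  pi_c_smooth : forall b, G b -> b.1 < E0 -> forall xs,
    smooth_path (fun t => ct t b xs);
  pi_Ainfty : forall t, t \in `[0, 1] ->
    cyclic_Ainfty_mod G n pair E0 (mt t);
  pi_c_cyclic : forall t, t \in `[0, 1] -> forall b, G b -> b.1 < E0 ->
    cyclic_symmetric pair (ct t b);
  pi_equation : forall b, G b -> b.1 < E0 -> forall ds xs, has_degs ds xs ->
    exists2 dm : R -> C, path_derivative (fun t => mt t b xs) dm &
      forall t, t \in `[0, 1] ->
        dm t + insertion_sum G (koszul R ds) (ct t) (mt t) b xs
             - insertion_sum G (fun=> 1) (mt t) (ct t) b xs = 0;
  pi_m_const : 0 < E0 -> forall s t, s \in `[0, 1] -> t \in `[0, 1] ->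
    forall xs, mt s 0 xs = mt t 0 xs;
  pi_c_zero : 0 < E0 -> forall t, t \in `[0, 1] ->
    forall xs, ct t 0 xs = 0
}.

(* The pseudo-isotopy goes from m0 (at t = 0) to m1 (at t = 1). *)
Definition joins_mod (R : realType) (G : set (R * int)) (C : gradedSpace R)
    (E0 : R) (mt : R -> operations C) (m0 m1 : operations C) : Prop :=
  forall b, G b -> b.1 < E0 -> forall xs,
    mt 0 b xs = m0 b xs /\ mt 1 b xs = m1 b xs.

Definition unital_pseudo_isotopy_mod (R : realType) (G : set (R * int))
    (C : gradedSpace R) (E0 : R) (mt ct : R -> operations C) (e : C) : Prop :=
  forall t, t \in `[0, 1] ->
    is_unit_mod G E0 (mt t) e /\
    forall b, G b -> b.1 < E0 -> forall xs ys, ct t b (xs ++ e :: ys) = 0.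

(* Main.v *)
(* Extend c by zero to E(beta) >= E0 and define m^t for these beta by solving
   dm/dt = m o c - c o m backwards from m^1 at t = 1. Only terms in which c
   takes a nonzero beta occur on the right, so this is a recursion on beta; it is
   well founded, although E(G) need not be locally finite, because an element of
   G has finitely many decompositions. Each required property is then
   propagated from t = 1: degrees and units because the right-hand side respects
   them, cyclicity because the commutator of cyclic operations is cyclic, and
   the A_infinity relation because the pre-Lie identity for insertions turns the
   derivative of Q = m o m into Q o c - c o Q, which vanishes by induction. *)

(* Three obstacles shape the proof. Koszul signs need degrees, but operations are functions of
   arbitrary lists, and the flow must be defined before anything is known about degrees; the signs
   are therefore carried by a linear involution [tau], equal to (-1)^(deg' x) on homogeneous x, and
   identities pass from homogeneous inputs to all inputs by multilinearity. The space may be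
   infinite dimensional and has no topology; a path is a finite combination with smooth
   coefficients, so integration, uniqueness of derivatives and preservation of a subspace reduce to
   finitely many real functions. Finally, c vanishes at (0,0), so a nonzero term of the flow at beta
   involves m only at an element with fewer decompositions than beta; this count measures both the
   recursion and the inductions. The conditions on m_{k,(0,0)} alone, perfectness among them, are
   not propagated by the flow: for 0 < E0 these operations are the given ones, and for E0 <= 0 the
   whole path is constant, equal to m^1. *)
Require Import Defs.
From HB Require Import structures.
From mathcomp Require Import all_boot all_order all_algebra.
From mathcomp Require Import all_classical all_reals all_analysis.
From mathcomp Require Import ring lra zify.
Import Order.TTheory GRing.Theory Num.Theory.
Import numFieldNormedType.Exports.
Local Open Scope classical_set_scope.
Local Open Scope ring_scope.

Set Implicit Arguments.
Unset Strict Implicit.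
Unset Printing Implicit Defensive.

(** * Smooth functions *)

Section SmoothFunctions.
Variable R : realType.
Implicit Types f g : R -> R.

(** Avoids formulas for n-th derivatives: it suffices to exhibit a class of functions stable under
    differentiation, such as the sums of products below. *)
Lemma smooth_coind (P : (R -> R) -> Prop) :
  (forall f, P f -> (forall t : R, derivable f t 1) /\ P (derive1 f)) ->
  forall f, P f -> smooth f.
Proof.
move=> hP f Pf n; suff: P (derive1n n f) by case/hP.
by elim: n => [//|n IH]; rewrite derive1nS; case: (hP _ IH).
Qed.

Lemma smooth_derivable f (t : R) : smooth f -> derivable f t 1.
Proof. exact: (fun h => h 0%N t). Qed.

Lemma smooth_derive1 f : smooth f -> smooth (derive1 f).
Proof. by move=> hf n t; have := hf n.+1 t; rewrite /derive1n iterSr. Qed.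

Lemma smoothI f : (forall t : R, derivable f t 1) -> smooth (derive1 f) -> smooth f.
Proof.
by move=> df hf [|n] t; [exact: df|rewrite /derive1n iterSr; exact: hf].
Qed.

Local Opaque smooth.

Lemma smooth_is_derive f (t : R) : smooth f -> is_derive t 1 f (derive1 f t).
Proof.
by move=> hf; apply: DeriveDef; [exact: smooth_derivable|rewrite derive1E].
Qed.

Lemma is_derive_derive1 f (t d : R) : is_derive t 1 f d -> derive1 f t = d.
Proof. by move=> h; rewrite derive1E derive_val. Qed.

Lemma is_derive_sum_prod (s : seq ((R -> R) * (R -> R))) (t : R) :
  (forall p, p \in s -> smooth p.1 /\ smooth p.2) ->
  is_derive t 1 (fun t => \sum_(p <- s) p.1 t * p.2 t)
    (\sum_(p <- s) (p.1 t * derive1 p.2 t + p.2 t * derive1 p.1 t)).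
Proof.
elim: s => [|p s IH] hs.
  have -> : (fun t => \sum_(p <- [::]) (p : (R -> R) * (R -> R)).1 t * p.2 t)
    = cst 0 by apply/funext => x; rewrite big_nil.
  by rewrite big_nil; exact: is_derive_cst.
have [h1 h2] := hs p (mem_head _ _).
have -> : (fun t => \sum_(p <- p :: s) p.1 t * p.2 t) =
   p.1 * p.2 + (fun t => \sum_(p <- s) p.1 t * p.2 t).
  by apply/funext => x; rewrite big_cons.
rewrite big_cons; apply: is_deriveD.
  exact: is_deriveM (smooth_is_derive t h1) (smooth_is_derive t h2).
by apply: IH => q qs; apply: hs; rewrite in_cons qs orbT.
Qed.

(** Single products are not stable under differentiation, but finite sums of them are: each pair (f,
    g) yields (f, g') and (g, f'). Products and sums of smooth functions are then special cases. *)
Lemma smooth_sum_prod (s : seq ((R -> R) * (R -> R))) :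
  (forall p, p \in s -> smooth p.1 /\ smooth p.2) ->
  smooth (fun t => \sum_(p <- s) p.1 t * p.2 t).
Proof.
move=> hs; pose P (f : R -> R) := exists2 s : seq ((R -> R) * (R -> R)),
  (forall p, p \in s -> smooth p.1 /\ smooth p.2) &
  f = (fun t => \sum_(p <- s) p.1 t * p.2 t).
apply: (@smooth_coind P); last by exists s.
move=> _ [{hs}s hs ->]; split => [t|].
  by have [] := @is_derive_sum_prod s t hs.
exists ([seq (p.1, derive1 p.2) | p <- s] ++ [seq (p.2, derive1 p.1) | p <- s]).
  move=> p; rewrite mem_cat => /orP[] /mapP[q /hs[h1 h2] ->].
    exact: conj h1 (smooth_derive1 h2).
  exact: conj h2 (smooth_derive1 h1).
apply/funext => t; rewrite (is_derive_derive1 (@is_derive_sum_prod s t hs)).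
by rewrite big_cat !big_map big_split.
Qed.

Lemma smooth_cst (k : R) : smooth (cst k).
Proof.
apply: (@smooth_coind (fun f => exists k, f = cst k)); last by exists k.
move=> _ [l ->]; split; first by move=> t; exact: derivable_cst.
by exists 0; apply/funext => t; rewrite derive1_cst.
Qed.

Lemma smoothM f g : smooth f -> smooth g -> smooth (fun t => f t * g t).
Proof.
move=> hf hg.
have -> : (fun t => f t * g t) = fun t => \sum_(p <- [:: (f, g)]) p.1 t * p.2 t.
  by apply/funext => t; rewrite big_seq1.
by apply: smooth_sum_prod => p; rewrite inE => /eqP ->; exact: conj hf hg.
Qed.

Lemma smoothD f g : smooth f -> smooth g -> smooth (fun t => f t + g t).
Proof.
move=> hf hg.
have -> : (fun t => f t + g t) =
    fun t => \sum_(p <- [:: (f, cst 1); (g, cst 1)]) p.1 t * p.2 t.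
  by apply/funext => t; rewrite !big_cons big_nil /= !mulr1 addr0.
apply: smooth_sum_prod => p; rewrite !inE => /orP[] /eqP ->.
  by split; [exact: hf|exact: smooth_cst].
by split; [exact: hg|exact: smooth_cst].
Qed.

Lemma derive1_smoothM f g (t : R) : smooth f -> smooth g ->
  derive1 (fun t => f t * g t) t = derive1 f t * g t + f t * derive1 g t.
Proof.
move=> /(@smooth_is_derive _ t) hf /(@smooth_is_derive _ t) hg.
apply: is_derive_derive1; apply: (is_derive_eq (is_deriveM hf hg)).
by rewrite /GRing.scale /= addrC mulrC.
Qed.

Lemma derive1_smoothD f g (t : R) : smooth f -> smooth g ->
  derive1 (fun t => f t + g t) t = derive1 f t + derive1 g t.
Proof.
move=> /(@smooth_is_derive _ t) hf /(@smooth_is_derive _ t) hg.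
exact: is_derive_derive1 (is_deriveD hf hg).
Qed.

Lemma is_derive0_cst f (x y : R) : x <= y ->
  (forall z, x <= z <= y -> is_derive z 1 f 0) -> f x = f y.
Proof.
move=> xy hf.
have [z zxy||z _ h] := @MVT_segment R f (fun=> 0) x y xy.
- by apply: hf; move: zxy; rewrite in_itv /= => /andP[/ltW -> /ltW ->].
- apply: derivable_within_continuous => t; rewrite in_itv /= => txy.
  by case: (hf t txy).
- by move: h; rewrite mul0r => /eqP; rewrite subr_eq0 => /eqP.
Qed.

Lemma cvg_ex_derive1 f (t : R) : derivable f t 1 ->
  h^-1 *: ((f \o shift t) (h *: (1 : R)) - f t) @[h --> 0^'] --> derive1 f t.
Proof. by move=> df; rewrite derive1E; exact: df. Qed.

(** Coefficients of a path are smooth on the whole line but matter only on [0,1]; this makes their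
    derivatives there, end points included, depend only on those values. Since a < b, one side of
    each point stays in [a,b], and the limit along that side decides. *)
Lemma smooth_eq0_derive1 f (a b : R) : a < b -> smooth f ->
  (forall t, a <= t <= b -> f t = 0) ->
  forall t, a <= t <= b -> derive1 f t = 0.
Proof.
move=> ab /smooth_derivable df f0 t /andP[at1 tb].
have cv := cvg_ex_derive1 (df t).
have key (F : set_system R) : ProperFilter F ->
    h^-1 *: ((f \o shift t) (h *: (1 : R)) - f t) @[h --> F] --> derive1 f t ->
    (\forall h \near F, a <= h + t <= b) -> derive1 f t = 0.
  move=> PF h1 near_ab.
  apply: (cvg_unique (@Rhausdorff R) h1); apply: cvg_near_cst.
  apply: filterS near_ab => h hab.
  by rewrite /= /GRing.scale /= mulr1 !f0 ?at1 // subrr mulr0.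
have [tb'|bt] := ltP t b.
  apply: (key 0^'+); first exact: cvg_dnbhs_at_right.
  near=> h; apply/andP; split.
    by rewrite (le_trans at1)// lerDr.
  rewrite -lerBrDr; near: h; apply: nbhs_right_le; by rewrite subr_gt0.
apply: (key 0^'-); first exact: cvg_dnbhs_at_left.
near=> h; apply/andP; split.
  rewrite -lerBlDr; near: h; apply: nbhs_left_ge; rewrite subr_lt0.
  exact: lt_le_trans ab bt.
by rewrite (le_trans _ tb)// gerDr.
Unshelve. all: by end_near. Qed.

Lemma continuous_antiderivative f : continuous f ->
  exists F : R -> R, forall x : R, is_derive x 1 F (f x).
Proof.
move=> cf; pose mu := @lebesgue_measure R.
pose F (a x : R) : R := (\int[mu]_(t in [set` `[a, x]]) f t)%R.
have dF (a x : R) : a < x -> is_derive x 1 (F a) (f x).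
  move=> ax; have xx1 : x < x + 1 by rewrite ltrDl.
  have fi : mu.-integrable `[a, x + 1] (EFin \o f).
    apply: continuous_compact_integrable; first exact: segment_compact.
    exact: continuous_subspaceT.
  have [d <-] := continuous_FTC1_closed xx1 fi ax (cf x).
  by apply: DeriveDef; [exact: d|rewrite derive1E].
have Findep (a b x : R) : a < x -> a < 0 -> b < x -> b < 0 ->
    F a x - F a 0 = F b x - F b 0.
  move=> ax a0 bx b0.
  have h (z : R) : a < z -> b < z -> is_derive z 1 (F a - F b) 0.
    move=> az bz; rewrite -(subrr (f z)).
    by apply: is_deriveB; exact: dF.
  suff H : (F a - F b) x = (F a - F b) 0.
    rewrite -[F a x](subrK (F b x)) (H : F a x - F b x = F a 0 - F b 0).
    by rewrite addrAC [X in X + _]addrAC subrr add0r addrC.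
  have [x0|/ltW x0] := leP x 0.
    by apply: is_derive0_cst => // z /andP[xz _]; apply: h;
      apply: lt_le_trans xz.
  by apply/esym/is_derive0_cst => // z /andP[xz _]; apply: h;
      apply: lt_le_trans xz.
(* The fundamental theorem differentiates the integral from [a] only at points beyond [a], so the
   base point moves with x; subtracting the value at 0 makes all base points agree ([Findep]). *)
exists (fun x => F (- (`|x| + 1)) x - F (- (`|x| + 1)) 0) => x.
have lb (y c : R) : `|y| < c -> - c < y /\ - c < 0.
  move=> yc; have := le_lt_trans (normr_ge0 y) yc.
  by move: yc; rewrite ltr_norml => /andP[? _] ?; rewrite oppr_lt0.
have [a1 a2] : - (`|x| + 1) < x /\ - (`|x| + 1) < 0 by apply: lb; rewrite ltrDl.
pose a := - (`|x| + 1).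
(* Near x, the moving base point of y may be replaced by the fixed [a], which still lies to the left
   of y and of 0. *)
apply: (@near_eq_is_derive _ _ _ (F a - cst (F a 0))); last first.
  rewrite -[f x]subr0; apply: is_deriveB; exact: dF.
near=> y.
have ay : a < y by near: y; exact: lt_nbhsr.
have [b1 b2] : - (`|y| + 1) < y /\ - (`|y| + 1) < 0 by apply: lb; rewrite ltrDl.
exact: Findep.
Unshelve. all: by end_near. Qed.

Lemma smooth_antiderivative f (c : R) : smooth f ->
  exists F : R -> R, [/\ smooth F, forall t, derive1 F t = f t & F 1 = c].
Proof.
move=> hf.
have [t|F hF] := @continuous_antiderivative f.
  by apply: differentiable_continuous; apply/derivable1_diffP/smooth_derivable.
have dF (k t : R) : is_derive t 1 (fun t => F t + k) (f t).
  by rewrite -[f t]addr0; apply: (@is_deriveD _ _ _ F (cst k)).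
have d1 k : derive1 (fun t => F t + k) = f.
  by apply/funext => t; apply: is_derive_derive1.
exists (fun t => F t + (c - F 1)); split; last by rewrite addrC subrK.
- by apply: smoothI; [move=> t; case: (dF (c - F 1) t)|rewrite d1].
- by move=> t; rewrite d1.
Qed.

End SmoothFunctions.

(** * Smooth paths in a vector space *)

Section Paths.
Variable R : realType.

Record smoothFun := SmoothFun { sf_val :> R -> R; sfP : smooth sf_val }.
Arguments sfP : clear implicits.

Local Opaque smooth.

Definition sfD (a b : smoothFun) := SmoothFun (smoothD (sfP a) (sfP b)).
Definition sfM (a b : smoothFun) := SmoothFun (smoothM (sfP a) (sfP b)).
Definition sfC (c : R) := @SmoothFun (cst c) (@smooth_cst R c).

Lemma sfCE c t : sfC c t = c. Proof. by []. Qed.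
Lemma sfDE a b t : sfD a b t = a t + b t. Proof. by []. Qed.
Lemma sfME a b t : sfM a b t = a t * b t. Proof. by []. Qed.
Lemma derive1_sfD (a b : smoothFun) (t : R) :
  derive1 (sfD a b) t = derive1 a t + derive1 b t.
Proof. by rewrite derive1_smoothD //; exact: sfP. Qed.
Lemma derive1_sfM (a b : smoothFun) (t : R) :
  derive1 (sfM a b) t = derive1 a t * b t + a t * derive1 b t.
Proof. by rewrite derive1_smoothM //; exact: sfP. Qed.
Lemma derive1_sfC c (t : R) : derive1 (sfC c) t = 0.
Proof. exact: derive1_cst. Qed.

Local Opaque sfD sfM sfC.

Notation I01 t := (t \in `[(0 : R), 1]).

Lemma in01_0 : I01 0. Proof. by rewrite in_itv /= lexx ler01. Qed.
Lemma in01_1 : I01 1. Proof. by rewrite in_itv /= lexx ler01. Qed.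

Section OneSpace.
Variable V : lmodType R.
Implicit Types (F f g : R -> V) (s : seq (smoothFun * V)).

Definition pval s t : V := \sum_(p <- s) p.1 t *: p.2.
Definition pder s (t : R) : V := \sum_(p <- s) derive1 p.1 t *: p.2.

(** Freeness, demanded by [path_expansion], is lost when two expansions are added. A vector
    depending on the others is absorbed into their coefficients; the dependence has constant
    coefficients, so values and derivatives follow together. *)
Lemma free_expansion s : exists k (e : 'I_k -> V) (a : 'I_k -> smoothFun),
  free_family e /\ forall t, pval s t = \sum_(i < k) a i t *: e i /\
    pder s t = \sum_(i < k) derive1 (a i) t *: e i.
Proof.
elim: s => [|[a v] s [k [e [b [fe IH]]]]].
  exists 0%N, (fun=> 0), (fun=> sfC 0); split; first by move=> c _ [].
  by move=> t; rewrite /pval /pder !big_nil !big_ord0.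
have [[c hc]|nc] := pselect (exists c : 'I_k -> R, v = \sum_(i < k) c i *: e i).
  exists k, e, (fun i => sfD (sfM (sfC (c i)) a) (b i)); split=> // t.
  rewrite /pval /pder !big_cons -/(pval s t) -/(pder s t).
  have [-> ->] := IH t.
  rewrite hc !scaler_sumr -!big_split; split; apply: eq_bigr => i _.
    by rewrite sfDE sfME sfCE scalerDl scalerA mulrC.
  by rewrite derive1_sfD derive1_sfM derive1_sfC mul0r add0r scalerDl scalerA
    [_ * c i]mulrC.
pose cons T (x : T) (y : 'I_k -> T) (i : 'I_k.+1) :=
  if unlift ord0 i is Some j then y j else x.
have cons0 T x y : @cons T x y ord0 = x by rewrite /cons unlift_none.
have consS T x y j : @cons T x y (lift ord0 j) = y j by rewrite /cons liftK.
exists k.+1, (cons _ v e), (cons _ a b); split; last first.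
  move=> t; rewrite /pval /pder !big_cons !big_ord_recl !cons0.
  rewrite -/(pval s t) -/(pder s t).
  have [-> ->] := IH t.
  by split; congr (_ + _); apply: eq_bigr => i _; rewrite !consS.
move=> c; rewrite big_ord_recl cons0.
under eq_bigr do rewrite consS.
move=> h0; have c0 : c ord0 = 0.
  apply/eqP; apply: contrapT => /negP c0; apply: nc.
  exists (fun i => - (c ord0)^-1 * c (lift ord0 i)).
  move/eqP: h0; rewrite addr_eq0 => /eqP h0.
  rewrite -[LHS]scale1r -(mulVf c0) -scalerA h0 scalerN -scaleNr scaler_sumr.
  by apply: eq_bigr => i _; rewrite scalerA.
move: h0; rewrite c0 scale0r add0r => /fe h i.
by case: (unliftP ord0 i) => [j|] ->.
Qed.

Lemma path_derivativeP F f : path_derivative F f <->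
  exists s, forall t, I01 t -> F t = pval s t /\ f t = pder s t.
Proof.
split=> [[k [e [a [[fe sa hF] hf]]]]|[s hs]].
  exists [seq (SmoothFun (sa i), e i) | i <- index_enum 'I_k] => t t01.
  by rewrite hF // hf // /pval /pder !big_map.
have [k [e [a [fe ha]]]] := free_expansion s.
exists k, e, a; split.
  split=> [//|i|t t01]; first exact: sfP.
  by have [-> _] := hs t t01; have [-> _] := ha t.
by move=> t t01; have [_ ->] := hs t t01; have [_ ->] := ha t.
Qed.

Lemma smooth_pathP F : smooth_path F <-> exists f, path_derivative F f.
Proof.
split=> [[k [e [a h]]]|[f [k [e [a [h _]]]]]]; last by exists k, e, a.
by exists (fun t => \sum_(i < k) derive1 (a i) t *: e i), k, e, a.
Qed.

Lemma path_derivative_smooth F f : path_derivative F f -> smooth_path F.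
Proof. by move=> h; apply/smooth_pathP; exists f. Qed.

Lemma path_derivative_eq F f F' f' :
  (forall t, I01 t -> F t = F' t) -> (forall t, I01 t -> f t = f' t) ->
  path_derivative F f -> path_derivative F' f'.
Proof.
move=> hF hf /path_derivativeP[s hs]; apply/path_derivativeP; exists s => t t01.
by rewrite -hF // -hf //; exact: hs.
Qed.

Lemma smooth_path_eq F F' : (forall t, I01 t -> F t = F' t) ->
  smooth_path F -> smooth_path F'.
Proof.
move=> h /smooth_pathP[f hf]; apply/smooth_pathP; exists f.
exact: (path_derivative_eq h _ hf).
Qed.

Lemma path_derivativeD F f G g : path_derivative F f -> path_derivative G g ->
  path_derivative (fun t => F t + G t) (fun t => f t + g t).
Proof.
move=> /path_derivativeP[s hs] /path_derivativeP[s' hs'].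
apply/path_derivativeP; exists (s ++ s') => t t01.
rewrite /pval /pder !big_cat -/(pval s t) -/(pder s t).
  have [-> ->] := hs t t01.
by have [-> ->] := hs' t t01.
Qed.

Lemma path_derivative_smul (a : smoothFun) F f : path_derivative F f ->
  path_derivative (fun t => a t *: F t)
    (fun t => derive1 a t *: F t + a t *: f t).
Proof.
move=> /path_derivativeP[s hs].
apply/path_derivativeP; exists [seq (sfM a p.1, p.2) | p <- s] => t t01.
rewrite /pval /pder !big_map /=; have [-> ->] := hs t t01.
rewrite /pval /pder !scaler_sumr -big_split /=; split; apply: eq_bigr => p _.
  by rewrite sfME scalerA.
by rewrite derive1_sfM scalerDl !scalerA.
Qed.

Lemma path_derivativeZ (a : R) F f : path_derivative F f ->
  path_derivative (fun t => a *: F t) (fun t => a *: f t).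
Proof.
move=> /(path_derivative_smul (sfC a)); apply: path_derivative_eq => t _.
  by [].
by rewrite derive1_sfC scale0r add0r.
Qed.

Lemma path_derivativeN F f : path_derivative F f ->
  path_derivative (fun t => - F t) (fun t => - f t).
Proof.
move=> /(path_derivativeZ (-1)); apply: path_derivative_eq => t _;
by rewrite scaleN1r.
Qed.

Lemma path_derivative_cst (v : V) : path_derivative (fun=> v) (fun=> 0).
Proof.
apply/path_derivativeP; exists [:: (sfC 1, v)] => t _.
by rewrite /pval /pder !big_seq1 derive1_sfC scale0r scale1r.
Qed.

Lemma path_derivative_sum (I : Type) (r : seq I) (F f : I -> R -> V) :
  (forall i, path_derivative (F i) (f i)) ->
  path_derivative (fun t => \sum_(i <- r) F i t) (fun t => \sum_(i <- r) f i t).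
Proof.
move=> h; elim: r => [|i r IH].
  by apply: path_derivative_eq (path_derivative_cst 0) => t _; rewrite big_nil.
by apply: path_derivative_eq (path_derivativeD (h i) IH) => t _;
  rewrite big_cons.
Qed.

(** Freeness turns the vanishing of f t into that of each coefficient's derivative, to which the
    real case applies. *)
Lemma path_derivative0_cst F f (u t : R) : path_derivative F f ->
  (forall t, I01 t -> f t = 0) -> I01 u -> I01 t -> F u = F t.
Proof.
move=> [k [e [a [[fe sa hF] hf]]]] f0.
have da0 i z : I01 z -> derive1 (a i) z = 0.
  by move=> z01; apply: (fe (fun i => derive1 (a i) z)); rewrite -hf // f0.
wlog ut : u t / u <= t.
  move=> H u01 t01; have [/H->//|/ltW/H->//] := leP u t.
move=> u01 t01; rewrite !hF //; apply: eq_bigr => i _; congr (_ *: _).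
apply: is_derive0_cst => // z /andP[uz zt]; rewrite -(da0 i z).
  exact: smooth_is_derive.
move: u01 t01; rewrite !in_itv /= => /andP[u0 _] /andP[_ t1].
by rewrite (le_trans u0) // (le_trans zt).
Qed.

(** The difference of two expansions of F is an expansion of the zero path in a free family, so its
    coefficients vanish on [0,1], and their derivatives with them. *)
Lemma path_derivative_unique F f g (t : R) : path_derivative F f ->
  path_derivative F g -> I01 t -> f t = g t.
Proof.
move=> hf hg t01.
have [k [e [a [[fe sa h0] ha]]]] : path_derivative (fun=> 0) (fun t => f t - g t).
  apply: path_derivative_eq (path_derivativeD hf (path_derivativeN hg)) => //.
  by move=> z _; rewrite subrr.
apply/eqP; rewrite -subr_eq0 ha //; apply/eqP/big1 => i _.
rewrite (@smooth_eq0_derive1 _ (a i) 0 1) ?scale0r //.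
  by move=> z z01; apply: (fe (fun i => a i z)); rewrite -h0.
Qed.

Lemma smooth_path_antiderivative f v : smooth_path f ->
  exists2 F, path_derivative F f & F 1 = v.
Proof.
move=> [k [e [a [_ sa hf]]]].
have /choice[A hA] i : exists A : smoothFun,
    (forall t : R, derive1 A t = a i t) /\ A 1 = 0.
  have [A [sA dA A1]] := smooth_antiderivative 0 (sa i).
  by exists (SmoothFun sA).
exists (fun t => \sum_(i < k) A i t *: e i + v).
  have h : path_derivative (fun t => \sum_(i < k) A i t *: e i) f.
    apply/path_derivativeP; exists [seq (A i, e i) | i <- index_enum 'I_k] => t t01.
    rewrite hf // /pval /pder !big_map; split=> //.
    by apply: eq_bigr => i _; rewrite (hA i).1.
  apply: path_derivative_eq (path_derivativeD h (path_derivative_cst v)) => //.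
  by move=> t _; rewrite addr0.
by rewrite big1 ?add0r // => i _; rewrite (hA i).2 scale0r.
Qed.

(** * Paths with values in a subspace *)

Section Subspace.
Variable S : set V.
Hypotheses (S0 : S 0) (SD : forall a x y, S x -> S y -> S (a *: x + y)).


(* If [a_0(t_0) <> 0], the first vector is
   traded for the value of the path at [t_0], which lies in [S]. *)
Lemma subspace_expansion s : (forall t, I01 t -> S (pval s t)) ->
  exists s' : seq (smoothFun * {x | S x}), forall t, I01 t ->
    pval s t = \sum_(p <- s') p.1 t *: proj1_sig p.2.
Proof.
have [n] := ubnP (size s); elim: n s => // n IH [|[a v] s] sn hs.
  by exists [::] => t _; rewrite /pval !big_nil.
have [[t0 t01 a0]|na] := pselect (exists2 t0, I01 t0 & a t0 != 0); last first.
  have E t : I01 t -> pval ((a, v) :: s) t = pval s t.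
    move=> t01; rewrite /pval big_cons; have [->|a0] := eqVneq (a t) 0.
      by rewrite scale0r add0r.
    by case: na; exists t.
  have [||s' hs'] := IH s; [by []|by move=> t t01; rewrite -E //; exact: hs|].
  by exists s' => t t01; rewrite E // hs'.
pose w : V := pval ((a, v) :: s) t0.
have Sw : S w by exact: hs.
pose b := sfM (sfC (a t0)^-1) a.
pose s1 := [seq (sfD p.1 (sfM (sfC (- p.1 t0)) b), p.2) | p <- s].
have E t : pval ((a, v) :: s) t = b t *: w + pval s1 t.
  rewrite /w /pval !big_cons big_map /= sfME sfCE scalerDr scalerA mulrAC.
  rewrite mulVf // mul1r -addrA; congr (_ + _).
  rewrite scaler_sumr -big_split /=; apply: eq_bigr => p _.
  rewrite sfDE !sfME !sfCE scalerA -scalerDl; congr (_ *: _).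
  by rewrite mulNr addrC [p.1 t0 * _]mulrC subrK.
have [||s' hs'] := IH s1.
- by rewrite size_map.
- move=> t tt; have -> : pval s1 t = (- b t) *: w + pval ((a, v) :: s) t.
    by rewrite E scaleNr addKr.
  by apply: SD => //; exact: hs.
exists ((b, exist _ w Sw) :: s') => t tt.
by rewrite E big_cons /= hs'.
Qed.

(** The expansion of f may use vectors outside S, so it is first rewritten with vectors of S; the
    antiderivative G of that finite sum stays in S. Then F - G is constant, and G 1 = 0. Applied to
    homogeneous parts, this keeps m^t in the right degree. *)
Lemma path_derivative_subspace F f : path_derivative F f ->
  (forall t, I01 t -> S (f t)) -> S (F 1) -> forall t, I01 t -> S (F t).
Proof.
move=> hF Sf SF1 t t01.
have [s hs] := (path_derivativeP _ _).1 hF.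
pose s1 := [seq (SmoothFun (smooth_derive1 (sfP p.1)), p.2) | p <- s].
have [z z01|s' hs'] := @subspace_expansion s1.
  by rewrite /pval big_map -/(pder s z) -(hs z z01).2; exact: Sf.
have /choice[A hA] (a : smoothFun) : exists A : smoothFun,
    (forall t : R, derive1 A t = a t) /\ A 1 = 0.
  have [A [sA dA A1]] := smooth_antiderivative 0 (sfP a).
  by exists (SmoothFun sA).
pose G t : V := \sum_(p <- s') A p.1 t *: proj1_sig p.2.
have hG : path_derivative G f.
  apply/path_derivativeP; exists [seq (A p.1, proj1_sig p.2) | p <- s'].
  move=> z z01; rewrite /pval /pder !big_map; split=> //.
  rewrite (hs z z01).2; have := hs' z z01; rewrite /pval big_map => E.
  rewrite /pder E; apply: eq_bigr => p _ /=.
  by rewrite (hA p.1).1.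
have -> : F t = 1 *: G t + F 1.
  apply/eqP; rewrite scale1r addrC -subr_eq; apply/eqP.
  rewrite (@path_derivative0_cst (fun t => F t - G t) _ t 1
    (path_derivativeD hF (path_derivativeN hG))) ?in01_1 //.
    by rewrite /G big1 ?subr0 // => p _; rewrite (hA p.1).2 scale0r.
  by move=> z _; rewrite subrr.
apply: SD => //; rewrite /G; elim/big_ind: _ => //.
  by move=> x y Sx Sy; rewrite -[x]scale1r; exact: SD.
by move=> p _; rewrite -[_ *: _]addr0; apply: SD => //; exact: (proj2_sig p.2).
Qed.

End Subspace.
End OneSpace.

Lemma path_derivative_linear (V W : lmodType R) (L : V -> W) (F f : R -> V) :
  linear L -> path_derivative F f ->
  path_derivative (fun t => L (F t)) (fun t => L (f t)).
Proof.
move=> linL; pose H := GRing.isLinear.Build R V W *:%R L linL.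
pose L' : {linear V -> W} := HB.pack L H.
move=> /path_derivativeP[s hs]; apply/path_derivativeP.
exists [seq (p.1, L p.2) | p <- s] => t t01; have [-> ->] := hs t t01.
rewrite /pval /pder !big_map -![L (\sum_(_ <- _) _)]/(L' _) !linear_sum /=.
by split; apply: eq_bigr => p _; rewrite -![L _]/(L' _) linearZ.
Qed.

(** Product rule for a moving linear map: F stays in the span of finitely many fixed vectors, so it
    is enough to differentiate [Phi t x] at these x. *)
Lemma path_derivative_apply (V W : lmodType R) (Phi dPhi : R -> V -> W)
    (F f : R -> V) :
  (forall t, I01 t -> linear (Phi t)) -> (forall t, I01 t -> linear (dPhi t)) ->
  (forall x, path_derivative (fun t => Phi t x) (fun t => dPhi t x)) ->
  path_derivative F f ->
  path_derivative (fun t => Phi t (F t)) (fun t => dPhi t (F t) + Phi t (f t)).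
Proof.
move=> linP lindP hP /path_derivativeP[s hs].
have lin_sum L (a : smoothFun * V -> R) : linear L ->
    (L (\sum_(p <- s) a p *: p.2) : W) = \sum_(p <- s) a p *: L p.2.
  move=> linL; pose H := GRing.isLinear.Build R V W *:%R L linL.
  pose L' : {linear V -> W} := HB.pack L H.
  rewrite -[L _]/(L' _) linear_sum; apply: eq_bigr => p _.
  by rewrite linearZ.
have := path_derivative_sum s (fun p => path_derivative_smul p.1 (hP p.2)).
apply: path_derivative_eq => t t01.
  by have [-> _] := hs t t01; rewrite lin_sum //; exact: linP.
have [-> ->] := hs t t01; rewrite !lin_sum; [|exact: linP|exact: lindP].
by rewrite -big_split /=; apply: eq_bigr => p _; rewrite addrC.
Qed.

End Paths.

(** * Insertion of one operation into another *)

Section Splits.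
Variable T : Type.
Implicit Types (l u v w : seq T).

(** The deconcatenation coproduct. Structural recursion makes its laws plain inductions, without the
    index arithmetic of [insertion_sum]; [big_splits2_ord] converts between the two. *)
Fixpoint splits l : seq (seq T * seq T) :=
  ([::], l) :: if l is x :: l' then [seq (x :: p.1, p.2) | p <- splits l']
               else [::].

Variable V : zmodType.

Lemma big_splits_nil (F : seq T -> seq T -> V) :
  \sum_(p <- splits [::]) F p.1 p.2 = F [::] [::].
Proof. exact: big_seq1. Qed.

Lemma big_splits_cons (F : seq T -> seq T -> V) x l :
  \sum_(p <- splits (x :: l)) F p.1 p.2 =
  F [::] (x :: l) + \sum_(p <- splits l) F (x :: p.1) p.2.
Proof. by rewrite big_cons big_map. Qed.

Lemma eq_big_splits (F H : seq T -> seq T -> V) l :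
  (forall u v, u ++ v = l -> F u v = H u v) ->
  \sum_(p <- splits l) F p.1 p.2 = \sum_(p <- splits l) H p.1 p.2.
Proof.
elim: l F H => [|x l IH] F H FH.
  by rewrite !big_splits_nil; exact: FH.
rewrite !big_splits_cons FH //; congr (_ + _).
by apply: (IH (fun u => F (x :: u)) (fun u => H (x :: u))) => u v uv;
  apply: FH; rewrite /= uv.
Qed.

(** Both sides run over the cuts of l into three consecutive pieces. *)
Lemma big_splits_coassoc (F : seq T -> seq T -> seq T -> V) l :
  \sum_(p <- splits l) \sum_(q <- splits p.1) F q.1 q.2 p.2 =
  \sum_(p <- splits l) \sum_(q <- splits p.2) F p.1 q.1 q.2.
Proof.
pose L u v := \sum_(q <- splits u) F q.1 q.2 v.
pose M u v := \sum_(q <- splits v) F u q.1 q.2.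
rewrite -/(\sum_(p <- splits l) L p.1 p.2) -/(\sum_(p <- splits l) M p.1 p.2).
rewrite {}/L {}/M; elim: l F => [|x l IH] F.
  rewrite (big_splits_nil (fun u v => \sum_(q <- splits u) F q.1 q.2 v)).
  by rewrite (big_splits_nil (fun u v => \sum_(q <- splits v) F u q.1 q.2)) /=
    !big_seq1.
rewrite (big_splits_cons (fun u v => \sum_(q <- splits u) F q.1 q.2 v)).
rewrite (big_splits_cons (fun u v => \sum_(q <- splits v) F u q.1 q.2)).
rewrite (big_splits_nil (fun u v => F u v (x :: l))).
under eq_bigr do rewrite (big_splits_cons (fun u v => F u v _)).
rewrite big_split /= (IH (fun u v w => F (x :: u) v w)).
by rewrite (big_splits_cons (fun u v => F [::] u v)) addrA.
Qed.

Lemma big_splits_insert (F : seq T -> seq T -> V) u x w :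
  \sum_(p <- splits (u ++ x :: w)) F p.1 p.2 =
  \sum_(q <- splits u) F q.1 (q.2 ++ x :: w) +
  \sum_(q <- splits w) F (u ++ x :: q.1) q.2.
Proof.
elim: u F => [|y u IH] F.
  by rewrite big_splits_cons (big_splits_nil (fun u v => F u (v ++ x :: w))).
rewrite [LHS]big_splits_cons.
rewrite [X in _ = X + _](big_splits_cons (fun u v => F u (v ++ x :: w))) -addrA.
by congr (_ + _); exact: (IH (fun u v => F (y :: u) v)).
Qed.

Lemma big_splits_rcons (F : seq T -> seq T -> V) l x :
  \sum_(p <- splits (rcons l x)) F p.1 p.2 =
  \sum_(p <- splits l) F p.1 (rcons p.2 x) + F (rcons l x) [::].
Proof.
rewrite -cats1 big_splits_insert (big_splits_nil (fun u v => F (l ++ x :: u) v)).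
by congr (_ + _); apply: eq_bigr => p _; rewrite cats1.
Qed.

End Splits.

Lemma splits_map (T U : Type) (f : T -> U) (l : seq T) :
  splits (map f l) = [seq (map f p.1, map f p.2) | p <- splits l].
Proof.
elim: l => //= x l IH; rewrite IH -!map_comp.
by congr (_ :: _); apply: eq_map.
Qed.

Section Insertion.
Variables (R : realType) (C : gradedSpace R).
Implicit Types (f g h : seq C -> C) (xs ys : seq C) (s : C -> C).

Lemma multilinear_opD f xs ys x y : multilinear_op f ->
  f (xs ++ (x + y) :: ys) = f (xs ++ x :: ys) + f (xs ++ y :: ys).
Proof. by move=> hf; have := hf xs ys 1 x y; rewrite !scale1r. Qed.

Lemma multilinear_op0 f xs ys : multilinear_op f -> f (xs ++ 0 :: ys) = 0.
Proof.
move=> hf; have := multilinear_opD xs ys 0 0 hf; rewrite addr0 => /eqP.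
by rewrite -subr_eq0 opprD addNKr oppr_eq0 => /eqP.
Qed.

Lemma multilinear_opZ f xs ys a x : multilinear_op f ->
  f (xs ++ (a *: x) :: ys) = a *: f (xs ++ x :: ys).
Proof.
move=> hf; have := hf xs ys a x 0.
by rewrite addr0 multilinear_op0 // addr0.
Qed.

Lemma multilinear_op_sum f xs ys (I : Type) (r : seq I) (F : I -> C) :
  multilinear_op f ->
  f (xs ++ (\sum_(i <- r) F i) :: ys) = \sum_(i <- r) f (xs ++ F i :: ys).
Proof.
move=> hf; elim: r => [|i r IH]; first by rewrite !big_nil multilinear_op0.
by rewrite !big_cons multilinear_opD // IH.
Qed.

Lemma linear_eq_fun (V W : lmodType R) (F H : V -> W) :
  F =1 H -> linear H -> linear F.
Proof. by move=> FH hH a x y; rewrite !FH; exact: hH. Qed.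

Lemma linear_sum_fun (V W : lmodType R) (I : Type) (r : seq I) (F : I -> V -> W) :
  (forall i, linear (F i)) -> linear (fun x => \sum_(i <- r) F i x).
Proof.
by move=> hF a x y; rewrite scaler_sumr -big_split; apply: eq_bigr => i _; exact: hF.
Qed.

Lemma linear_add_fun (V W : lmodType R) (F H : V -> W) :
  linear F -> linear H -> linear (fun x => F x + H x).
Proof.
by move=> hF hH a x y; rewrite hF hH scalerDr addrACA.
Qed.

Lemma linear_sub_fun (V W : lmodType R) (F H : V -> W) :
  linear F -> linear H -> linear (fun x => F x - H x).
Proof.
by move=> hF hH a x y; rewrite hF hH scalerDr scalerN opprD addrACA.
Qed.

(* Sum of the [f (x_1, ..., g (x_i, ...), ..., x_k)], the entries before the
   inserted one being twisted by [s]; with [s] the shifted-parity involution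
   this produces the Koszul signs with no reference to the degrees. *)
Definition insertion s f g xs : C :=
  \sum_(p <- splits xs) \sum_(q <- splits p.2) f (map s p.1 ++ g q.1 :: q.2).

(** The part of inserting g and then h in which both become separate arguments of f, with g on the
    left. The twist s' acts on the original entries before h, those consumed by g included; s acts
    on the arguments before g. *)
Definition insertion2 s s' f g h xs : C :=
  \sum_(a <- splits xs) \sum_(b <- splits a.2) \sum_(c <- splits b.2)
    \sum_(d <- splits c.2)
    f (map s (map s' a.1) ++ g (map s' b.1) :: map s' c.1 ++ h d.1 :: d.2).

(** Three groups, by the place of g relative to x: before it, around it, after it. Only in the last
    is x twisted. *)
Lemma insertion_cat s f g xs x ys :
  insertion s f g (xs ++ x :: ys) =
    \sum_(p <- splits xs) \sum_(q <- splits p.2)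
       f (map s p.1 ++ g q.1 :: q.2 ++ x :: ys) +
    \sum_(p <- splits xs) \sum_(q <- splits ys)
       f (map s p.1 ++ g (p.2 ++ x :: q.1) :: q.2) +
    \sum_(p <- splits ys) \sum_(q <- splits p.2)
       f (map s xs ++ s x :: map s p.1 ++ g q.1 :: q.2).
Proof.
pose K u v := \sum_(q <- splits v) f (map s u ++ g q.1 :: q.2).
rewrite /insertion (big_splits_insert K); congr (_ + _).
  rewrite -big_split /=; apply: eq_bigr => p _.
  by rewrite /K (big_splits_insert (fun v w => f (map s p.1 ++ g v :: w))).
by apply: eq_bigr => p _; apply: eq_bigr => q _; rewrite map_cat -catA.
Qed.

Lemma insertion_multilinear s f g : linear s ->
  multilinear_op f -> multilinear_op g -> multilinear_op (insertion s f g).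
Proof.
move=> hs hf hg xs ys.
apply: (linear_eq_fun (fun x => insertion_cat s f g xs x ys)).
apply: linear_add_fun; first apply: linear_add_fun.
- apply: linear_sum_fun => p; apply: linear_sum_fun => q a x y.
  by rewrite -!cat_cons !catA; exact: hf.
- apply: linear_sum_fun => p; apply: linear_sum_fun => q a x y.
  by rewrite hg; exact: hf.
- apply: linear_sum_fun => p; apply: linear_sum_fun => q a x y.
  by rewrite hs; exact: hf.
Qed.

(* The pre-Lie identity: [h] is inserted inside, to the right of, or to the left
   of the arguments of [g]. *)
Lemma insertion_insertion s s' f g h xs : multilinear_op f ->
  insertion s' (insertion s f g) h xs =
    insertion (s \o s') f (insertion s' g h) xs + insertion2 s s' f g h xs +
    \sum_(a <- splits xs) \sum_(b <- splits a.2) \sum_(c <- splits b.2)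
    \sum_(d <- splits c.2)
    f (map s (map s' a.1) ++ s (h b.1) :: map s c.1 ++ g d.1 :: d.2).
Proof.
move=> hf; pose K a b c := f (map s a ++ g b :: c).
have -> : insertion s' (insertion s f g) h xs =
  \sum_(p <- splits xs) \sum_(q <- splits p.2)
    (\sum_(r <- splits p.1) \sum_(t <- splits r.2)
      K (map s' r.1) (map s' t.1) (map s' t.2 ++ h q.1 :: q.2) +
     \sum_(r <- splits p.1) \sum_(t <- splits q.2)
      K (map s' r.1) (map s' r.2 ++ h q.1 :: t.1) t.2 +
     \sum_(r <- splits q.2) \sum_(t <- splits r.2)
      f (map s (map s' p.1) ++ s (h q.1) :: map s r.1 ++ g t.1 :: t.2)).
  apply: eq_bigr => p _; apply: eq_bigr => q _.
  rewrite insertion_cat splits_map !big_map; congr (_ + _ + _).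
  by apply: eq_bigr => r _; rewrite splits_map big_map.
under eq_bigr do rewrite !big_split /=.
rewrite !big_split /=; congr (_ + _); rewrite addrC; congr (_ + _).
(* The terms with h inside g: the outer cut is at h and the inner ones at g, and repeated
   coassociativity brings the cut at g outside. *)
- rewrite /insertion.
  under [RHS]eq_bigr do under eq_bigr do
    (rewrite multilinear_op_sum //; under eq_bigr do rewrite multilinear_op_sum //).
  pose F (a m c : seq C) : C := \sum_(r <- splits c) \sum_(t <- splits r.2)
    K (map s' a) (map s' m ++ h r.1 :: t.1) t.2.
  transitivity (\sum_(p <- splits xs) \sum_(q <- splits p.1) F q.1 q.2 p.2).
    by apply: eq_bigr => p _; rewrite exchange_big.
  rewrite big_splits_coassoc; apply: eq_bigr => p _; rewrite {}/F.
  pose F (m z c : seq C) : C := \sum_(t <- splits z)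
    f (map (s \o s') p.1 ++ g (map s' m ++ h t.1 :: t.2) :: c).
  transitivity (\sum_(q <- splits p.2) \sum_(r <- splits q.2) F q.1 r.1 r.2).
    apply: eq_bigr => q _; rewrite /F /K -map_comp.
    by rewrite (big_splits_coassoc
      (fun v w c => f (map (s \o s') p.1 ++ g (map s' q.1 ++ h v :: w) :: c))).
  by rewrite -(big_splits_coassoc F).
- pose F (a m c : seq C) : C := \sum_(t <- splits m) \sum_(q <- splits c)
    K (map s' a) (map s' t.1) (map s' t.2 ++ h q.1 :: q.2).
  transitivity (\sum_(p <- splits xs) \sum_(q <- splits p.1) F q.1 q.2 p.2).
    apply: eq_bigr => p _; rewrite exchange_big; apply: eq_bigr => r _.
    by rewrite exchange_big.
  rewrite big_splits_coassoc; apply: eq_bigr => p _; rewrite /F /K.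
  by rewrite (big_splits_coassoc (fun b u v => \sum_(q <- splits v)
    f (map s (map s' p.1) ++ g (map s' b) :: map s' u ++ h q.1 :: q.2))).
Qed.

(** Identifies the third sum of the pre-Lie identity with an [insertion2] in which g and h are
    exchanged; moving the twist s past h costs the sign k. *)
Lemma insertion2_swap s s' f g h xs (k : R) : s \o s' =1 s' \o s ->
  multilinear_op f ->
  (forall v, h (map s v) = k *: s (h v)) ->
  insertion2 s' s f h g xs = k *:
    \sum_(a <- splits xs) \sum_(b <- splits a.2) \sum_(c <- splits b.2)
    \sum_(d <- splits c.2)
    f (map s (map s' a.1) ++ s (h b.1) :: map s c.1 ++ g d.1 :: d.2).
Proof.
move=> ss hf hh; rewrite scaler_sumr; apply: eq_bigr => a _.
rewrite scaler_sumr; apply: eq_bigr => b _.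
rewrite scaler_sumr; apply: eq_bigr => c _.
rewrite scaler_sumr; apply: eq_bigr => d _.
by rewrite hh multilinear_opZ // -!map_comp (eq_map ss).
Qed.

End Insertion.

(** * Koszul signs *)

Section Grading.
Variables (R : realType) (C : gradedSpace R).

Definition psign (d : int) : R := (-1) ^ d.

Lemma psignD d e : psign (d + e) = psign d * psign e.
Proof. by rewrite /psign expfzDr // oppr_eq0 oner_eq0. Qed.

Lemma psign0 : psign 0 = 1. Proof. exact: expr0z. Qed.
Lemma psign1 : psign 1 = -1. Proof. exact: expr1z. Qed.

Lemma psign_even d : psign (d * 2) = 1.
Proof. by rewrite /psign mulrC -exprz_exp -exprnP sqrrN expr1n exp1rz. Qed.

Lemma psignDeven d e : psign (d + e * 2) = psign d.
Proof. by rewrite psignD psign_even mulr1. Qed.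

Lemma psignN d : psign (- d) = psign d.
Proof. by rewrite -(psignDeven (- d) d); congr psign; ring. Qed.

Lemma psign_sqr d : psign d * psign d = 1.
Proof. by rewrite -psignD -(psign_even d); congr psign; ring. Qed.

(** [gr_span] allows repeated degrees while [gr_direct] wants distinct ones, so components of equal
    degree are merged. One f' serves all weights, because plain and sign-weighted sums are compared
    later. *)
Lemma gr_sum_uniq (s s' : seq int) (f : int -> C) : uniq s' ->
  {subset s <= s'} -> (forall j, gr_part j (f j)) ->
  exists2 f' : int -> C, forall j, gr_part j (f' j) &
    forall w : int -> R,
      \sum_(j <- s) w j *: f j = \sum_(j <- s') w j *: f' j.
Proof.
move=> us'; elim: s => [|i s IH] ss' hf.
  exists (fun=> 0) => [j|w]; first exact: gr_zero.
  by rewrite big_nil big1 // => j _; rewrite scaler0.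
have [j js||f' hf' h] := IH; [|exact: hf|].
  by apply: ss'; rewrite in_cons js orbT.
exists (fun j => (j == i)%:R *: f j + f' j) => [j|w].
  by apply: gr_lin; [exact: hf|exact: hf'].
rewrite big_cons h; under [RHS]eq_bigr do rewrite scalerDr.
rewrite big_split /= [X in _ = X + _](bigD1_seq i) ?ss' ?mem_head //=.
rewrite eqxx scale1r [X in _ = _ + X + _]big1 ?addr0 // => j /negPf ji.
by rewrite ji scale0r scaler0.
Qed.

Lemma gr_sum_uniq1 (s s' : seq int) (f : int -> C) : uniq s' ->
  {subset s <= s'} -> (forall j, gr_part j (f j)) ->
  exists f' : int -> C, [/\ forall j, gr_part j (f' j),
    \sum_(j <- s) f j = \sum_(j <- s') f' j &
    forall w : int -> R,
      \sum_(j <- s) w j *: f j = \sum_(j <- s') w j *: f' j].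
Proof.
move=> us' ss' hf; have [f' hf' e] := gr_sum_uniq us' ss' hf.
exists f'; split=> //.
have E (r : seq int) (h : int -> C) :
    \sum_(j <- r) (1 : R) *: h j = \sum_(j <- r) h j.
  by apply: eq_bigr => j _; rewrite scale1r.
by have := e (fun=> 1); rewrite !E.
Qed.

(** Homogeneous decompositions are only known to exist, so the map starts as a relation [P] between
    x and its sign-weighted sums. [P] is linear and relates 0 only to 0, hence is single-valued. The
    exponent is j - 1 because deg' = deg - 1. *)
Lemma parity_involution_exists : exists tau : C -> C, linear tau /\
  forall d x, shifted C d x -> tau x = psign d *: x.
Proof.
pose P (x y : C) := exists (s : seq int) (f : int -> C),
  [/\ forall j, gr_part j (f j), x = \sum_(j <- s) f j &
      y = \sum_(j <- s) psign (j - 1) *: f j].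
have Plin a x y x' y' : P x x' -> P y y' -> P (a *: x + y) (a *: x' + y').
  move=> [s [f [hf -> ->]]] [s2 [f2 [hf2 -> ->]]].
  have us := undup_uniq (s ++ s2).
  have [j||f' [hf' e0 e1]] := @gr_sum_uniq1 s _ f us; [|exact: hf|].
    by rewrite mem_undup mem_cat => ->.
  have [j||f2' [hf2' e3 e2]] := @gr_sum_uniq1 s2 _ f2 us; [|exact: hf2|].
    by rewrite mem_undup mem_cat orbC => ->.
  exists (undup (s ++ s2)), (fun j => a *: f' j + f2' j); split.
  - by move=> j; exact: gr_lin.
  - by rewrite e0 e3 scaler_sumr -big_split.
  - rewrite e1 e2 scaler_sumr -big_split; apply: eq_bigr => j _.
    by rewrite scalerDr !scalerA [a * _]mulrC.
have P0 y : P 0 y -> y = 0.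
  move=> [s [f [hf h0 ->]]].
  have [j||f' [hf' e0 e]] := @gr_sum_uniq1 s _ f (undup_uniq s); [|exact: hf|].
    by rewrite mem_undup.
  move: e0; rewrite -h0 => /esym/(gr_direct (undup_uniq s) hf') f0.
  by rewrite e big_seq big1 // => j js; rewrite f0 // scaler0.
have /choice[tau htau] x : exists y, P x y.
  have [s [f [hf ->]]] := gr_span x.
  by exists (\sum_(j <- s) psign (j - 1) *: f j), s, f.
have uniq_tau x y : P x y -> tau x = y.
  move=> Pxy; apply/eqP; rewrite -subr_eq0; apply/eqP/P0.
  have := Plin (-1) _ _ _ _ Pxy (htau x).
  by rewrite !scaleN1r addNr addrC.
exists tau; split=> [a x y|d x hx].
  exact: uniq_tau (Plin _ _ _ _ _ (htau x) (htau y)).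
apply: uniq_tau; exists [:: d + 1], (fun j => if j == d + 1 then x else 0).
split.
- by move=> j; case: eqP => [->|_] //; exact: gr_zero.
- by rewrite big_seq1 eqxx.
- by rewrite big_seq1 eqxx addrK.
Qed.

(* The second components are the intended shifted degrees. *)
Fixpoint homl (l : seq (C * int)) : Prop :=
  if l is p :: l' then shifted C p.2 p.1 /\ homl l' else True.

Lemma homl_cat l l' : homl (l ++ l') <-> homl l /\ homl l'.
Proof. by elim: l => [|p l IH] /=; tauto. Qed.

Definition dg (l : seq (C * int)) : int := \sum_(p <- l) p.2.

Lemma dg_cons p l : dg (p :: l) = p.2 + dg l.
Proof. exact: big_cons. Qed.
Lemma dg_cat l l' : dg (l ++ l') = dg l + dg l'.
Proof. exact: big_cat. Qed.
Lemma dg_nil : dg [::] = 0.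
Proof. exact: big_nil. Qed.

Lemma has_degs_cons d x ds xs : has_degs (d :: ds) (x :: xs) <->
  shifted C d x /\ has_degs ds xs.
Proof.
split=> [[/= [sz] h]|[hx [sz h]]].
  by split; [exact: (h 0%N)|split=> // i ix; exact: (h i.+1)].
by split=> [|[|i]] //=; [rewrite sz|exact: h].
Qed.

Lemma homl_has_degs l : homl l <-> has_degs (unzip2 l) (unzip1 l).
Proof.
elim: l => [|[x d] l IH]; first by split=> // _; split.
by rewrite /= has_degs_cons -IH.
Qed.

Lemma has_degsP ds xs : has_degs ds xs ->
  exists l, [/\ homl l, unzip1 l = xs & unzip2 l = ds].
Proof.
move=> h; exists (zip xs ds); have sz := h.1.
have e1 : unzip1 (zip xs ds) = xs by rewrite unzip1_zip // sz.
have e2 : unzip2 (zip xs ds) = ds by rewrite unzip2_zip // sz.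
by split=> //; apply/homl_has_degs; rewrite e1 e2.
Qed.

Lemma sum_unzip2 l : \sum_(d <- unzip2 l) d = dg l.
Proof. by rewrite /dg big_map. Qed.

Lemma has_degree_homl f r l : has_degree f r -> homl l ->
  shifted C (dg l + r) (f (unzip1 l)).
Proof. by move=> hf /homl_has_degs/hf; rewrite sum_unzip2. Qed.

(** Carries relations stated for homogeneous inputs to all lists, so that they can be used as
    equalities of functions. *)
Lemma multilinear_op_ext f g : multilinear_op f -> multilinear_op g ->
  (forall l, homl l -> f (unzip1 l) = g (unzip1 l)) -> f =1 g.
Proof.
move=> mf mg fg.
(* Entries are expanded from the right: [xs] is still arbitrary, [l] already homogeneous. *)
suff H xs : forall l, homl l -> f (xs ++ unzip1 l) = g (xs ++ unzip1 l).
  by move=> xs; have := H xs [::] I; rewrite cats0.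
elim/last_ind: xs => [|xs x IH] l hl; first exact: fg.
have [s [c [hc ->]]] := gr_span x.
rewrite -cats1 -!catA /= !multilinear_op_sum //; apply: eq_bigr => j _.
by apply: (IH ((c j, j - 1) :: l)); split=> //=; rewrite /shifted subrK.
Qed.

Lemma linear_ext_hom (V : lmodType R) (f g : C -> V) : linear f -> linear g ->
  (forall d x, shifted C d x -> f x = g x) -> f =1 g.
Proof.
move=> lf lg fg x; have [s [c [hc ->]]] := gr_span x.
elim: s => [|j s IH].
  rewrite !big_nil; apply: (fg 0); exact: gr_zero.
rewrite !big_cons -[c j]scale1r lf lg IH (fg (j - 1)) //.
by rewrite /shifted subrK.
Qed.

(** The sign of moving an operation of degree r past an entry: s is the parity involution for odd r
    and the identity for even r. *)
Definition koszul_twist (s : C -> C) (r : int) : Prop :=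
  linear s /\ forall d x, shifted C d x -> s x = psign (r * d) *: x.

Lemma koszul_twist_id r : psign r = 1 -> koszul_twist id r.
Proof.
move=> hr; split=> [a x y //|d x _].
by rewrite /psign -exprz_exp -/(psign r) hr exp1rz scale1r.
Qed.

Lemma multilinear_op_twist f s r xs l ys : multilinear_op f ->
  koszul_twist s r -> homl l ->
  f (xs ++ map s (unzip1 l) ++ ys) = psign (r * dg l) *: f (xs ++ unzip1 l ++ ys).
Proof.
move=> mf [_ hs]; elim: l xs => [|[x d] l IH] xs /=.
  by rewrite dg_nil mulr0 psign0 scale1r.
move=> [hx hl]; rewrite (hs d) // multilinear_opZ // -!cat_rcons IH //.
by rewrite dg_cons mulrDr psignD scalerA.
Qed.

(** The output degree is the sum of the input degrees plus r, which leaves the sign (-1)^r. The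
    degree condition thus becomes a rule that mentions no degrees of inputs, as [insertion2_swap]
    requires. *)
Lemma op_twist f s r : multilinear_op f -> linear s -> has_degree f r ->
  (forall d x, shifted C d x -> s x = psign d *: x) ->
  forall xs, f (map s xs) = psign r *: s (f xs).
Proof.
move=> mf ls df hs.
apply: multilinear_op_ext.
- move=> xs ys a x y; rewrite !map_cat /= ls; exact: mf.
- by move=> xs ys a x y; rewrite mf ls scalerDr !scalerA [a * _]mulrC.
move=> l hl; have tw : koszul_twist s 1.
  by split=> // d x hx; rewrite mul1r; exact: hs.
have := multilinear_op_twist [::] [::] mf tw hl; rewrite /= !cats0 => ->.
rewrite (hs _ _ (has_degree_homl df hl)) scalerA psignD mulrCA.
by rewrite psign_sqr mulr1 mul1r.
Qed.

End Grading.

(** * Decompositions in the monoid *)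

Section Bridge.
Variables (T : Type) (V : zmodType).

Lemma big_splits_ord (F : seq T -> seq T -> V) l :
  \sum_(p <- splits l) F p.1 p.2 = \sum_(i < (size l).+1) F (take i l) (drop i l).
Proof.
elim: l F => [|x l IH] F; first by rewrite big_splits_nil big_ord1.
rewrite big_splits_cons big_ord_recl /=; congr (_ + _).
exact: (IH (fun u v => F (x :: u) v)).
Qed.

Lemma big_splits2_ord (K : seq T -> seq T -> seq T -> V) l :
  \sum_(p <- splits l) \sum_(q <- splits p.2) K p.1 q.1 q.2 =
  \sum_(k < (size l).+1) \sum_(i < (size l - k).+1)
    K (take i l) (take k (drop i l)) (drop (i + k) l).
Proof.
rewrite (big_splits_ord (fun u v => \sum_(q <- splits v) K u q.1 q.2)).
under eq_bigr do rewrite big_splits_ord size_drop.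
pose H i k := K (take i l) (take k (drop i l)) (drop (i + k) l).
transitivity (\sum_(i < (size l).+1)
    \sum_(k < (size l).+1 | (k < (size l - i).+1)%N) H i k).
  apply: eq_bigr => i _.
  rewrite -(big_ord_widen (size l).+1 (H i)); last by rewrite ltnS leq_subr.
  by apply: eq_bigr => k _; rewrite drop_drop addnC.
rewrite (exchange_big_dep xpredT) //; apply: eq_bigr => k _.
rewrite [RHS](big_ord_widen (size l).+1 (H ^~ k)); last by rewrite ltnS leq_subr.
apply: eq_bigl => i; have := ltn_ord i; have := ltn_ord k; lia.
Qed.

End Bridge.

Lemma finite_set_inj (T U : Type) (A : set T) (f : T -> U) :
  (forall x y, A x -> A y -> f x = f y -> x = y) ->
  finite_set (f @` A) -> finite_set A.
Proof.
move=> inj; rewrite (@eq_finite_set _ _ (f @` A) A) //.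
by apply: inj_card_eq => x y /set_mem Ax /set_mem Ay; exact: inj.
Qed.

Section Decompositions.
Variables (R : realType) (G : set (R * int)).
Hypothesis hG : discrete_submonoid G.

(** If mu(b) were nonzero, the multiples of b would be infinitely many elements of energy 0, against
    the finiteness of the fibres. *)
Lemma energy_zero b : G b -> b.1 = 0 -> b = 0.
Proof.
move=> Gb b0.
have Gn n : G (b *+ n).
  elim: n => [|n IH]; first by rewrite mulr0n; exact: dsm_zero hG.
  by rewrite mulrS; exact: (dsm_add hG).
have e n : b *+ n = (0, b.2 *+ n).
  elim: n => [|n IH]; first by rewrite !mulr0n.
  by rewrite !mulrS IH {1}[b]surjective_pairing b0; congr pair; rewrite addr0.
rewrite [b]surjective_pairing b0; congr pair.
apply/eqP/negP => /negP b2; apply: infinite_nat.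
have -> : [set: nat] = (fun n => b *+ n) @^-1` [set b | G b /\ b.1 = 0].
  by apply/seteqP; split=> n //= _; split; [exact: Gn|rewrite e].
apply: finite_preimage; last exact: (dsm_fiber_finite hG).
by move=> x y _ _; rewrite !e => -[]; exact: mulrIn.
Qed.

(* If [b = p1 + p2 = q1 + q2], then [p1 + q2] has energy [E b + E p1 - E q1]; as
   [E b] is isolated, the energies of the first components are separated. *)
Lemma decompositions_finite b : finite_set (decompositions G b).
Proof.
have [Gb|nGb] := pselect (G b); last first.
  apply: (sub_finite_set _ (@finite_set0 _)) => p [g1 g2 e]; apply: nGb.
  by rewrite -e; exact: (dsm_add hG).
have [_ [V nV hV]] := dsm_discrete hG (ex_intro2 _ _ b Gb erefl).
have /nbhs_ballP[eps /= eps0 hball] := nV.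
have sep x : G x -> `|b.1 - x.1| < eps -> x.1 = b.1.
  move=> Gx xb; suff : (V `&` fst @` G) x.1 by rewrite hV.
  by split; [exact: hball|exists x].
pose P := fst @` decompositions G b.
have : finite_set P.
  pose N := (Num.trunc (b.1 / eps)).+1.
  pose A := fst @` P.
  have bound p : decompositions G b p -> 0 <= p.1.1 <= b.1.
    move=> [g1 g2 <-]; rewrite (dsm_energy_ge0 hG g1) /=.
    by rewrite lerDl (dsm_energy_ge0 hG g2).
  have fA : finite_set A.
    (* Energies are binned into cells of width [eps]: if those of p.1 and q.1 share a cell, p.1 +
       q.2 has energy within [eps] of E(b), hence equal to it. *)
    apply: (@finite_set_inj _ _ _ (fun x => Num.trunc (x / eps))).
      move=> x y [_ [p Dp <-] <-] [_ [q Dq <-] <-] /= pq.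
      have [/andP[p0 _] /andP[q0 _]] := (bound p Dp, bound q Dq).
      have /truncn_itv/andP[p1 p2] : 0 <= p.1.1 / eps by rewrite divr_ge0 // ltW.
      have /truncn_itv/andP[q1 q2] : 0 <= q.1.1 / eps by rewrite divr_ge0 // ltW.
      have [gp1 gp2 ep] := Dp; have [gq1 gq2 eq] := Dq.
      have eb : p.1.1 + q.2.1 = b.1.
        apply: (sep (p.1 + q.2) (dsm_add hG gp1 gq2)).
        rewrite -{1}eq /= opprD addrACA subrr addr0.
        rewrite -[_ - _](mulfVK (lt0r_neq0 eps0)) mulrBl normrM (gtr0_norm eps0).
        rewrite gtr_pMl // ltr_norml; move: p1 p2 q1 q2; rewrite pq -natr1.
        by set u := (_ %:R : R) => *; apply/andP; split; lra.
      by apply: (addIr q.2.1); rewrite eb -eq.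
    apply: (sub_finite_set _ (finite_II N)) => _ [_ [_ [p Dp <-] <-] <-] /=.
    have /andP[p0 pb] := bound p Dp.
    rewrite /N ltnS; apply: le_truncn.
    by rewrite ler_pM2r ?invr_gt0.
  apply: (sub_finite_set _ (bigcup_finite fA (fun l _ => dsm_fiber_finite hG l))).
  by move=> _ [p Dp <-]; exists p.1.1; [exists p.1; [exists p|]|case: Dp].
apply: finite_set_inj => p q [_ _ ep] [_ _ eq] pq.
rewrite [p]surjective_pairing [q]surjective_pairing pq; congr pair.
by apply: (addrI p.1); rewrite ep {1}pq eq.
Qed.

Definition decs b : seq ((R * int) * (R * int)) :=
  finmap.enum_fset (fset_set (decompositions G b)).

Lemma mem_decs b p : (p \in decs b) = (p \in decompositions G b).
Proof. exact: in_fset_set (decompositions_finite b) p. Qed.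

Lemma decsP b p : reflect (decompositions G b p) (p \in decs b).
Proof. by rewrite mem_decs; apply: (iffP idP) => [/set_mem|/mem_set]. Qed.

Lemma decs_uniq b : uniq (decs b). Proof. exact: finmap.fset_uniq. Qed.

Lemma decs_energy b p : p \in decs b -> p.1.1 <= b.1 /\ p.2.1 <= b.1.
Proof.
move=> /decsP[/(dsm_energy_ge0 hG) g1 /(dsm_energy_ge0 hG) g2 <-].
by rewrite lerDl lerDr.
Qed.

Variable V : zmodType.

Lemma big_decs_swap (F : R * int -> R * int -> V) b :
  \sum_(p <- decs b) F p.1 p.2 = \sum_(p <- decs b) F p.2 p.1.
Proof.
pose sw (p : (R * int) * (R * int)) := (p.2, p.1).
rewrite -[RHS](big_map sw xpredT (fun p => F p.1 p.2)).
apply: perm_big; apply: uniq_perm; first exact: decs_uniq.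
  by rewrite map_inj_uniq ?decs_uniq // => -[? ?] [? ?] [-> ->].
have h p : p \in decs b -> sw p \in decs b.
  by move=> /decsP[? ? ?]; apply/decsP; split=> //=; rewrite addrC.
move=> p; apply/idP/mapP => [/h hp|[q /h hq ->] //].
by exists (sw p) => //; case: p {hp}.
Qed.

Lemma big_decs_assoc (K : R * int -> R * int -> R * int -> V) b :
  \sum_(p <- decs b) \sum_(q <- decs p.1) K q.1 q.2 p.2 =
  \sum_(p <- decs b) \sum_(q <- decs p.2) K p.1 q.1 q.2.
Proof.
pose KK (t : (R * int) * (R * int) * (R * int)) := K t.1.1 t.1.2 t.2.
rewrite -(@big_allpairs_dep _ _ _ _ (fun=> _) _ (fun p q => (q.1, q.2, p.2))
  (decs b) (fun p => decs p.1) KK).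
rewrite -(@big_allpairs_dep _ _ _ _ (fun=> _) _ (fun p q => (p.1, q.1, q.2))
  (decs b) (fun p => decs p.2) KK).
apply: perm_big; apply: uniq_perm.
- apply: allpairs_uniq_dep; first exact: decs_uniq.
    by move=> p _; exact: decs_uniq.
  move=> _ _ /allpairsPdep[p [q [hp hq ->]]] /allpairsPdep[p' [q' [hp' hq' ->]]].
  case: p q p' q' hp hq hp' hq' => [p1 p2] [q1 q2] [p1' p2'] [q1' q2'] /=.
  move=> _ /decsP[_ _ /= <-] _ /decsP[_ _ /= <-] [-> -> ->]; done.
- apply: allpairs_uniq_dep; first exact: decs_uniq.
    by move=> p _; exact: decs_uniq.
  move=> _ _ /allpairsPdep[p [q [hp hq ->]]] /allpairsPdep[p' [q' [hp' hq' ->]]].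
  case: p q p' q' hp hq hp' hq' => [p1 p2] [q1 q2] [p1' p2'] [q1' q2'] /=.
  move=> _ /decsP[_ _ /= <-] _ /decsP[_ _ /= <-] [-> -> ->]; done.
move=> [[x y] z]; apply/allpairsPdep/allpairsPdep.
  move=> [[p1 p2] [[q1 q2] [/decsP[/= g1 g2 e] /decsP[/= g3 g4 e'] [-> -> ->]]]].
  exists (q1, q2 + p2), (q2, p2); split=> //; apply/decsP; split=> //=.
    exact: (dsm_add hG).
  by rewrite addrA e' e.
move=> [[p1 p2] [[q1 q2] [/decsP[/= g1 g2 e] /decsP[/= g3 g4 e'] [-> -> ->]]]].
exists (p1 + q1, q2), (p1, q1); split=> //; apply/decsP; split=> //=.
  exact: (dsm_add hG).
by rewrite -addrA e' e.
Qed.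

(** Induction measure in place of the energy, whose values on G are not assumed to be well
    ordered. *)
Definition rank b : nat := size (decs b).

(** Adding p.2 to the second component injects the decompositions of p.1 into those of b. The image
    misses (b, 0): energies are nonnegative and only 0 has energy 0, so y + p.2 = 0 would force p.2
    = 0. *)
Lemma rank_lt b p : p \in decs b -> p.2 != 0 -> (rank p.1 < rank b)%N.
Proof.
move=> /decsP[g1 g2 e] p20.
pose f (q : (R * int) * (R * int)) := (q.1, q.2 + p.2).
have fi : injective f.
  move=> [x y] [x' y'] exy; have e1 : x = x' := congr1 fst exy.
  have e2 : y + p.2 = y' + p.2 := congr1 snd exy.
  by rewrite e1 (addIr _ e2).
rewrite /rank -(size_map f) -[(size _).+1]/(size ((b, 0) :: map f (decs p.1))).
apply: uniq_leq_size.
  rewrite /= map_inj_uniq // decs_uniq andbT.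
  apply/mapP => -[[x y] /decsP[/= gx gy exy] bxy].
  have y0 : 0 = y + p.2 := congr1 snd bxy.
  have y1 : y.1 = 0.
    have ey := dsm_energy_ge0 hG gy; have ep := dsm_energy_ge0 hG g2.
    have : y.1 + p.2.1 = 0 := esym (congr1 fst y0).
    by move=> /eqP; rewrite paddr_eq0 // => /andP[/eqP h _].
  by move: y0; rewrite (energy_zero gy y1) add0r => /esym/eqP; rewrite (negPf p20).
move=> q; rewrite in_cons => /orP[/eqP ->|/mapP[r /decsP[gr1 gr2 er] ->]].
  apply/decsP; split; [rewrite -e; exact: (dsm_add hG)|exact: dsm_zero hG|].
  exact: addr0.
apply/decsP; split=> //=; first exact: (dsm_add hG).
by rewrite addrA er.
Qed.

Lemma rank_lt2 b p : p \in decs b -> p.1 != 0 -> (rank p.2 < rank b)%N.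
Proof.
move=> pb; apply: (@rank_lt b (p.2, p.1)).
by move/decsP: pb => [g1 g2 e]; apply/decsP; split=> //=; rewrite addrC.
Qed.

End Decompositions.

(** * Degree and cyclicity of insertions *)

Section Algebra.
Variables (R : realType) (C : gradedSpace R).

Lemma insertion_suml (I : Type) (r : seq I) s (F : I -> seq C -> C) g xs :
  insertion s (fun ys => \sum_(i <- r) F i ys) g xs =
  \sum_(i <- r) insertion s (F i) g xs.
Proof.
rewrite /insertion exchange_big; apply: eq_bigr => p _.
by rewrite exchange_big.
Qed.

Lemma insertion_subl s (f f' : seq C -> C) g xs :
  insertion s (fun ys => f ys - f' ys) g xs =
  insertion s f g xs - insertion s f' g xs.
Proof.
rewrite -sumrB; apply: eq_bigr => p _.
by rewrite -sumrB.
Qed.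

Lemma insertion_sumr (I : Type) (r : seq I) s f (F : I -> seq C -> C) xs :
  multilinear_op f ->
  insertion s f (fun ys => \sum_(i <- r) F i ys) xs =
  \sum_(i <- r) insertion s f (F i) xs.
Proof.
move=> mf; rewrite /insertion exchange_big; apply: eq_bigr => p _.
rewrite exchange_big; apply: eq_bigr => q _.
by rewrite multilinear_op_sum.
Qed.

Lemma insertion_subr s f (g g' : seq C -> C) xs : multilinear_op f ->
  insertion s f (fun ys => g ys - g' ys) xs =
  insertion s f g xs - insertion s f g' xs.
Proof.
move=> mf; rewrite -sumrB; apply: eq_bigr => p _.
rewrite -sumrB; apply: eq_bigr => q _.
by rewrite multilinear_opD // -scaleN1r multilinear_opZ // scaleN1r.
Qed.

Lemma insertion_0l s g (xs : seq C) : insertion s (fun=> 0) g xs = 0.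
Proof. by apply: big1 => p _; apply: big1. Qed.

Lemma insertion_0r s f (xs : seq C) : multilinear_op f ->
  insertion s f (fun=> 0) xs = 0.
Proof.
by move=> mf; apply: big1 => p _; apply: big1 => q _; exact: multilinear_op0.
Qed.

Lemma eq_insertion s f f' g g' (xs : seq C) : f =1 f' -> g =1 g' ->
  insertion s f g xs = insertion s f' g' xs.
Proof. by move=> /funext -> /funext ->. Qed.

Lemma insertion_degree s r f g rf rg : koszul_twist s r ->
  multilinear_op f ->
  has_degree f rf -> has_degree g rg ->
  has_degree (insertion (C := C) s f g) (rf + rg).
Proof.
move=> hs mf df dg_ ds xs /has_degsP[l [hl <- <-]].
rewrite sum_unzip2 /insertion splits_map big_map.
have gD j x y : gr_part j x -> gr_part j y -> gr_part j (x + y :> C).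
  by move=> hx hy; rewrite -[x]scale1r; exact: gr_lin.
have step u v w : u ++ v ++ w = l ->
    shifted C (dg l + (rf + rg)) (f (map s (unzip1 u) ++ g (unzip1 v) :: unzip1 w)).
  move=> e; move: hl; rewrite -e => /homl_cat[hu /homl_cat[hv hw]].
  rewrite (multilinear_op_twist [::] (g (unzip1 v) :: unzip1 w) mf hs hu) /=.
  have h : homl (u ++ (g (unzip1 v), dg v + rg) :: w).
    by apply/homl_cat; split=> //; split=> //=; exact: has_degree_homl.
  have := has_degree_homl df h; rewrite /unzip1 map_cat /= => h'.
  rewrite -[_ *: _]addr0; apply: gr_lin; last exact: gr_zero.
  by move: h'; rewrite !dg_cat dg_cons /shifted /=; congr gr_part; ring.
pose F (u v : seq (C * int)) :=
  \sum_(q <- splits v) f (map s (unzip1 u) ++ g (unzip1 q.1) :: unzip1 q.2).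
under eq_bigr do rewrite splits_map big_map.
have key (S : C -> Prop) (H : seq (C * int) -> seq (C * int) -> C) l' :
    S 0 -> (forall x y, S x -> S y -> S (x + y)) ->
    (forall u v, u ++ v = l' -> S (H u v)) ->
    S (\sum_(p <- splits l') H p.1 p.2).
  move=> S0 SD; elim: l' H => [|y l' IH] H hH.
    by rewrite big_splits_nil; exact: hH.
  rewrite big_splits_cons; apply: SD; first exact: hH.
  by apply: (IH (fun u => H (y :: u))) => u v uv; apply: hH; rewrite /= uv.
pose S := shifted C (dg l + (rf + rg)).
apply: (key S F l); [exact: gr_zero|by move=> x y; exact: gD|move=> u v uv].
apply: (key S (fun q1 q2 : seq (C * int) => f (map s (unzip1 u) ++ g (unzip1 q1) :: unzip1 q2))).
- exact: gr_zero.
- by move=> x y; exact: gD.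
- by move=> v' w vw; apply: step; rewrite vw.
Qed.

Section Cyclic.
Variables (n : int) (pair : C -> C -> R).
Hypothesis hp : cyclic_pairing n pair.

Lemma pairDl x x' y : pair (x + x') y = pair x y + pair x' y.
Proof. by have := pair_linear_l hp y 1 x x'; rewrite scale1r mul1r. Qed.

Lemma pair0l y : pair 0 y = 0.
Proof.
by apply: (addrI (pair 0 y)); rewrite -pairDl !addr0.
Qed.

Lemma pairZl a x y : pair (a *: x) y = a * pair x y.
Proof. by have := pair_linear_l hp y a x 0; rewrite pair0l !addr0. Qed.

Lemma pairBl x x' y : pair (x - x') y = pair x y - pair x' y.
Proof. by rewrite pairDl -scaleN1r pairZl mulN1r. Qed.

Lemma pair_suml (I : Type) (r : seq I) (F : I -> C) y :
  pair (\sum_(i <- r) F i) y = \sum_(i <- r) pair (F i) y.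
Proof.
elim: r => [|i r IH]; first by rewrite !big_nil pair0l.
by rewrite !big_cons pairDl IH.
Qed.

Let U := @unzip1 C int.

Lemma cyclic_homl f l x0 d0 y e : cyclic_symmetric pair f -> homl l ->
  shifted C d0 x0 -> shifted C e y ->
  pair (f (rcons (U l) y)) x0 = psign R (d0 * (dg l + e)) * pair (f (x0 :: U l)) y.
Proof.
move=> cf /homl_has_degs hl h0 hy.
by rewrite (cf _ _ _ _ _ _ h0 hl hy) sum_unzip2.
Qed.

Let term f g s z u v w := pair (f (map s (U u) ++ g (U v) :: U w)) z.

Lemma pair_insertion s f g z l :
  pair (insertion s f g (U l)) z =
  \sum_(p <- splits l) \sum_(q <- splits p.2) term f g s z p.1 q.1 q.2.
Proof.
rewrite pair_suml splits_map big_map; apply: eq_bigr => p _.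
by rewrite pair_suml splits_map big_map.
Qed.

Section Terms.
Variables (f g : seq C -> C) (rf rg : int) (s : C -> C).
Hypotheses (mf : multilinear_op f) (cf : cyclic_symmetric pair f)
  (cg : cyclic_symmetric pair g)
  (df : has_degree f rf) (dgg : has_degree g rg) (hs : koszul_twist s rg)
  (rfg : psign R (rf * rg) = 1).
Variables (x0 xk : C) (d0 dk : int).
Hypotheses (h0 : shifted C d0 x0) (hk : shifted C dk xk).

Lemma term_twist z u v w : homl u -> term f g s z u v w =
  psign R (rg * dg u) * pair (f (U u ++ g (U v) :: U w)) z.
Proof.
move=> hu; rewrite /term.
by rewrite (multilinear_op_twist [::] (g (U v) :: U w) mf hs hu) pairZl.
Qed.

Lemma term_rotate_after u v w : homl u -> homl v -> homl w ->
  term f g s x0 u v (rcons w (xk, dk)) =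
  psign R (d0 * (dg (u ++ v ++ w) + dk)) * term f g s xk ((x0, d0) :: u) v w.
Proof.
move=> hu hv hw; rewrite !term_twist //.
have hgv := has_degree_homl dgg hv.
have hl : homl (u ++ (g (U v), dg v + rg) :: w) by apply/homl_cat.
have := cyclic_homl cf hl h0 hk.
rewrite /U /unzip1 map_rcons map_cat /= -rcons_cons -rcons_cat => ->.
rewrite !mulrA -!psignD; congr (psign R _ * _).
by rewrite !dg_cat !dg_cons /=; ring.
Qed.

Lemma term_rotate_empty l : homl l ->
  term f g s x0 (rcons l (xk, dk)) [::] [::] =
  psign R (d0 * (dg l + dk)) * term f g s xk [::] [::] ((x0, d0) :: l).
Proof.
move=> hl; have hlk : homl (rcons l (xk, dk)).
  by rewrite -cats1; apply/homl_cat.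
have hg0 : shifted C rg (g [::]).
  by have := has_degree_homl dgg (l := [::]) I; rewrite dg_nil add0r.
have hl0 : homl ((x0, d0) :: l) by [].
rewrite !term_twist //.
rewrite [X in f X](_ : _ = rcons (U (rcons l (xk, dk))) (g [::])); last first.
  by rewrite cats1.
rewrite (cyclic_homl cf hlk h0 hg0).
rewrite [X in f X](_ : _ = rcons (U ((x0, d0) :: l)) xk); last first.
  by rewrite /U /unzip1 map_rcons.
rewrite (cyclic_homl cf hl0 hg0 hk) /=.
rewrite !mulrA -!psignD; congr (_ * _).
rewrite -[RHS](psignDeven R _ (rg * (dg l + dk + d0))); congr psign.
by rewrite -cats1 !dg_cat !dg_cons dg_nil /=; ring.
Qed.

(** A rotation of f leaves the pairing of f(x_0, ...) with g(..., x_k); symmetry puts g first, and a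
    rotation of g brings x_k outside. The minus is the 1 in the exponent of [pair_sym]. *)
Lemma term_rotate_inside s' u v : homl u -> homl v ->
  term f g s x0 u (rcons v (xk, dk)) [::] =
  - (psign R (d0 * (dg (u ++ v) + dk)) * term g f s' xk [::] ((x0, d0) :: u) v).
Proof.
move=> hu hv; have hvk : homl (rcons v (xk, dk)).
  by rewrite -cats1; apply/homl_cat.
have hu0 : homl ((x0, d0) :: u) by [].
have hgv := has_degree_homl dgg hvk.
have hfu := has_degree_homl df hu0.
rewrite term_twist //.
rewrite [X in f X](_ : _ = rcons (U u) (g (U (rcons v (xk, dk))))); last first.
  by rewrite cats1.
rewrite (cyclic_homl cf hu h0 hgv).
rewrite (pair_sym hp hfu hgv) -/(psign R _).
rewrite [X in g X](_ : _ = rcons (U v) xk); last by rewrite /U /unzip1 map_rcons.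
rewrite (cyclic_homl cg hv hfu hk) /term /=.
rewrite !mulrA -!psignD -mulNr; congr (_ * _).
rewrite -mulN1r -(psign1 R) -[psign R 1]mulr1 -rfg -!psignD.
(* The two exponents differ by twice this integer, once [rf * rg] has been inserted through
   [rfg]. *)
rewrite -[RHS](psignDeven R _ ((d0 + dg u + rf) * (dg v + dk) + rg * (dg u + d0))).
congr psign.
by rewrite -cats1 !dg_cat !dg_cons dg_nil /=; ring.
Qed.

End Terms.

(* Rotating [(x_1, ..., x_k | x_0)] to [(x_0, ..., x_(k-1) | x_k)] preserves the
   terms of [f o g] in which neither [x_0] nor [x_k] enters [g], as well as those
   where [g] has no argument and is moved from the end to the beginning. When
   [x_k] enters [g], the symmetry of the pairing exchanges the roles of [f] and
   [g], which produces a term of [g o f]. *)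
Lemma insertion_commutator_cyclic f g rf rg sf sg :
  multilinear_op f -> multilinear_op g ->
  cyclic_symmetric pair f -> cyclic_symmetric pair g ->
  has_degree f rf -> has_degree g rg ->
  koszul_twist sf rf -> koszul_twist sg rg -> psign R (rf * rg) = 1 ->
  cyclic_symmetric pair
    (fun xs => insertion sg f g xs - insertion sf g f xs).
Proof.
move=> mf mg cf cg df dgg hsf hsg rfg d0 x0 ds xs dk xk h0 hxs hk.
have [l [hl <- <-]] := has_degsP hxs; rewrite sum_unzip2 -/(psign R _).
set kappa := psign R _.
have rgf : psign R (rg * rf) = 1 by rewrite mulrC.
have -> : rcons (unzip1 l) xk = U (rcons l (xk, dk)).
  by rewrite /U /unzip1 map_rcons.
have -> : x0 :: unzip1 l = U ((x0, d0) :: l) by [].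
rewrite !pairBl !pair_insertion.
have Lsum f' g' s' : \sum_(p <- splits (rcons l (xk, dk)))
    \sum_(q <- splits p.2) term f' g' s' x0 p.1 q.1 q.2 =
  \sum_(p <- splits l) \sum_(q <- splits p.2)
     term f' g' s' x0 p.1 q.1 (rcons q.2 (xk, dk)) +
  \sum_(p <- splits l) term f' g' s' x0 p.1 (rcons p.2 (xk, dk)) [::] +
  term f' g' s' x0 (rcons l (xk, dk)) [::] [::].
  rewrite (big_splits_rcons (fun u v => \sum_(q <- splits v) term f' g' s' x0 u q.1 q.2)).
  rewrite (big_splits_nil (fun v w => term f' g' s' x0 (rcons l (xk, dk)) v w)).
  rewrite -big_split /=; congr (_ + _); apply: eq_bigr => p _.
  exact: (big_splits_rcons (fun v w => term f' g' s' x0 p.1 v w)).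
have Rsum f' g' s' : \sum_(p <- splits ((x0, d0) :: l))
    \sum_(q <- splits p.2) term f' g' s' xk p.1 q.1 q.2 =
  \sum_(p <- splits l) \sum_(q <- splits p.2)
     term f' g' s' xk ((x0, d0) :: p.1) q.1 q.2 +
  \sum_(p <- splits l) term f' g' s' xk [::] ((x0, d0) :: p.1) p.2 +
  term f' g' s' xk [::] [::] ((x0, d0) :: l).
  rewrite (big_splits_cons (fun u v => \sum_(q <- splits v) term f' g' s' xk u q.1 q.2)).
  rewrite (big_splits_cons (fun v w => term f' g' s' xk [::] v w)).
  by rewrite [LHS]addrC addrA addrAC.
have L1 f' g' s' rg' : multilinear_op f' -> cyclic_symmetric pair f' ->
    has_degree g' rg' -> koszul_twist s' rg' ->
    \sum_(p <- splits l) \sum_(q <- splits p.2)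
       term f' g' s' x0 p.1 q.1 (rcons q.2 (xk, dk)) =
    kappa * \sum_(p <- splits l) \sum_(q <- splits p.2)
       term f' g' s' xk ((x0, d0) :: p.1) q.1 q.2.
  move=> mf' cf' dg' hs'; rewrite mulr_sumr.
  apply: (eq_big_splits (F := fun u v => \sum_(q <- splits v)
       term f' g' s' x0 u q.1 (rcons q.2 (xk, dk)))
    (H := fun u v => kappa * \sum_(q <- splits v)
       term f' g' s' xk ((x0, d0) :: u) q.1 q.2)) => u r ur.
  rewrite mulr_sumr; apply: (eq_big_splits
    (F := fun v w => term f' g' s' x0 u v (rcons w (xk, dk)))
    (H := fun v w => kappa * term f' g' s' xk ((x0, d0) :: u) v w)) => v w vw.
  move: (hl); rewrite -ur -vw => /homl_cat[hu /homl_cat[hv hw]].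
  by rewrite (term_rotate_after mf' cf' dg' hs' h0 hk hu hv hw) vw ur.
have L2 f' g' s' s'' rf' rg' : multilinear_op f' -> cyclic_symmetric pair f' ->
    cyclic_symmetric pair g' ->
    has_degree f' rf' -> has_degree g' rg' -> koszul_twist s' rg' ->
    psign R (rf' * rg') = 1 ->
    \sum_(p <- splits l) term f' g' s' x0 p.1 (rcons p.2 (xk, dk)) [::] =
    - (kappa * \sum_(p <- splits l) term g' f' s'' xk [::] ((x0, d0) :: p.1) p.2).
  move=> mf' cf' cg' df' dg' hs' rfg'; rewrite mulr_sumr -sumrN.
  apply: (eq_big_splits
    (F := fun u v => term f' g' s' x0 u (rcons v (xk, dk)) [::])
    (H := fun u v => - (kappa * term g' f' s'' xk [::] ((x0, d0) :: u) v))) => u v uv.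
  move: (hl); rewrite -uv => /homl_cat[hu hv].
  by rewrite (term_rotate_inside mf' cf' cg' df' dg' hs' rfg' h0 hk s'' hu hv) uv.
rewrite !Lsum !Rsum.
rewrite (L1 f g sg rg) // (L1 g f sf rf) //.
rewrite (L2 f g sg sf rf rg) // (L2 g f sf sg rg rf) //.
rewrite (term_rotate_empty mf cf dgg hsg h0 hk hl).
rewrite (term_rotate_empty mg cg df hsf h0 hk hl) -/kappa.
(* The sums of [L1] match within f o g and within g o f; those of [L2] cross over, and their minus
   is the one of the commutator. *)
ring.
Qed.

End Cyclic.
End Algebra.

(** * Insertions summed over the monoid *)

Section GappedInsertion.
Variables (R : realType) (C : gradedSpace R) (G : set (R * int)).
Hypothesis hG : discrete_submonoid G.
Implicit Types (f g m c : operations C) (b : R * int).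

Definition gapped_insertion (s : C -> C) f g b (xs : seq C) : C :=
  \sum_(p <- decs G b) insertion s (f p.1) (g p.2) xs.

Lemma insertion_sum1E f g b xs :
  insertion_sum G (fun=> 1) f g b xs = gapped_insertion id f g b xs.
Proof.
rewrite /insertion_sum fsbig_finite; last exact: decompositions_finite.
apply: eq_bigr => p _.
rewrite /insertion (big_splits2_ord (fun u v w => f p.1 (map id u ++ g p.2 v :: w))).
by apply: eq_bigr => k _; apply: eq_bigr => i _; rewrite map_id scale1r.
Qed.

(** Exchanges the explicit signs of the definitions for [tau]: on homogeneous entries, twisting the
    first i of them is multiplication by the Koszul sign. *)
Lemma insertion_sum_koszulE (tau : C -> C) f g b ds xs : has_degs ds xs ->
  koszul_twist tau 1 -> (forall p, p \in decs G b -> multilinear_op (f p.1)) ->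
  insertion_sum G (koszul R ds) f g b xs = gapped_insertion tau f g b xs.
Proof.
move=> /has_degsP[l [hl <- <-]] htau mf.
rewrite /insertion_sum fsbig_finite; last exact: decompositions_finite.
apply: eq_big_seq => p /mf mfp.
rewrite /insertion (big_splits2_ord (fun u v w => f p.1 (map tau u ++ g p.2 v :: w))).
apply: eq_bigr => k _; apply: eq_bigr => i _.
have hli : homl (take i l) by move: hl; rewrite -{1}(cat_take_drop i l) => /homl_cat[].
rewrite -map_take -/(unzip1 _) (multilinear_op_twist [::] _ mfp htau hli) mul1r.
by rewrite /koszul -map_take sum_unzip2.
Qed.

Lemma eq_gapped_insertion s f f' g g' b xs :
  (forall p, p \in decs G b -> f p.1 =1 f' p.1) ->
  (forall p, p \in decs G b -> g p.2 =1 g' p.2) ->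
  gapped_insertion s f g b xs = gapped_insertion s f' g' b xs.
Proof.
by move=> ff gg; apply: eq_big_seq => p hp; apply: eq_insertion; [exact: ff|exact: gg].
Qed.

Lemma gapped_insertion_eq0 s f g b xs :
  (forall p, p \in decs G b -> insertion s (f p.1) (g p.2) xs = 0) ->
  gapped_insertion s f g b xs = 0.
Proof. by move=> h; apply: big1_seq => p /andP[_]; exact: h. Qed.

Lemma linear_sum_in (I : eqType) (V W : lmodType R) (r : seq I) (F : I -> V -> W) :
  (forall i, i \in r -> linear (F i)) -> linear (fun x => \sum_(i <- r) F i x).
Proof.
move=> hF a x y; rewrite scaler_sumr -big_split.
by apply: eq_big_seq => i ir; exact: hF.
Qed.

Lemma gapped_insertion_multilinear s f g b : linear s ->
  (forall p, p \in decs G b -> multilinear_op (f p.1)) ->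
  (forall p, p \in decs G b -> multilinear_op (g p.2)) ->
  multilinear_op (gapped_insertion s f g b).
Proof.
move=> ls mf mg xs ys; apply: linear_sum_in => p hp.
by apply: insertion_multilinear; [exact: ls|exact: mf|exact: mg].
Qed.

(* The right-hand side of the evolution equation dm/dt = m o c - c o m. *)
Definition flow (tau : C -> C) m c b (xs : seq C) : C :=
  gapped_insertion id m c b xs - gapped_insertion tau c m b xs.

Lemma flow_multilinear tau m c b : linear tau ->
  (forall p, p \in decs G b -> multilinear_op (m p.1)) ->
  (forall p, p \in decs G b -> multilinear_op (c p.1)) ->
  multilinear_op (flow tau m c b).
Proof.
have sw f : (forall p, p \in decs G b -> multilinear_op (f p.1)) ->
    forall p, p \in decs G b -> multilinear_op (f p.2 : seq C -> C).
  move=> hf p pb; apply: (hf (p.2, p.1)).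
  by move/(decsP hG): pb => [g1 g2 e]; apply/(decsP hG); split=> //=; rewrite addrC.
move=> lt mm mc xs ys; apply: linear_sub_fun.
  apply: (gapped_insertion_multilinear _ mm); last exact: sw.
  by move=> a x y.
by apply: (gapped_insertion_multilinear _ mc) => //; exact: sw.
Qed.

Section Identity.
Variables (tau : C -> C) (m c : operations C) (ok : R * int -> Prop).
Hypotheses (tauK : involutive tau)
  (ok_decs : forall b p, ok b -> p \in decs G b -> ok p.1 /\ ok p.2)
  (mm : forall b, ok b -> multilinear_op (m b))
  (mc : forall b, ok b -> multilinear_op (c b))
  (m_odd : forall b, ok b -> forall xs, m b (map tau xs) = - tau (m b xs))
  (c_even : forall b, ok b -> forall xs, c b (map tau xs) = tau (c b xs)).

(** The remainders left by the pre-Lie identity. c is even and passes the twist freely; m is odd and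
    contributes -1, so the third remainder is antisymmetric in y and z. *)
Lemma insertion_flow_term x y z xs : ok x -> ok y -> ok z ->
  [/\ insertion tau (insertion id (m x) (c y)) (m z) xs =
      insertion tau (m x) (insertion tau (c y) (m z)) xs +
      (insertion2 id tau (m x) (c y) (m z) xs +
       insertion2 tau id (m x) (m z) (c y) xs),
      insertion id (insertion tau (m x) (m y)) (c z) xs =
      insertion tau (m x) (insertion id (m y) (c z)) xs +
      (insertion2 id tau (m x) (c z) (m y) xs +
       insertion2 tau id (m x) (m y) (c z) xs) &
      insertion tau (insertion tau (c x) (m y)) (m z) xs =
      insertion id (c x) (insertion tau (m y) (m z)) xs +
      (insertion2 tau tau (c x) (m y) (m z) xs -
       insertion2 tau tau (c x) (m z) (m y) xs)].
Proof.
move=> ox oy oz; split.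
- rewrite insertion_insertion; last exact: mm.
  rewrite -addrA; congr (_ + (_ + _)).
  rewrite (@insertion2_swap _ _ id tau (m x) (c y) (m z) xs 1) ?scale1r //.
    exact: mm.
  by move=> v; rewrite map_id scale1r.
- rewrite insertion_insertion; last exact: mm.
  rewrite -addrA; congr (_ + _); rewrite addrC; congr (_ + _).
  rewrite (@insertion2_swap _ _ tau id (m x) (m y) (c z) xs 1) ?scale1r //.
    exact: mm.
  by move=> v; rewrite c_even // scale1r.
- rewrite insertion_insertion; last exact: mc.
  have -> : tau \o tau = id by apply/funext => v /=; exact: tauK.
  rewrite -addrA; congr (_ + (_ + _)).
  rewrite (@insertion2_swap _ _ tau tau (c x) (m y) (m z) xs (-1)).
  - by rewrite scaleN1r opprK.
  - by [].
  - exact: mc.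
  - by move=> v; rewrite m_odd // scaleN1r.
Qed.

(* With [dm/dt = flow], the left-hand side is the derivative of [m o m]. *)
Lemma gapped_insertion_flow b xs : ok b ->
  gapped_insertion tau (flow tau m c) m b xs +
  gapped_insertion tau m (flow tau m c) b xs =
  gapped_insertion id (gapped_insertion tau m m) c b xs -
  gapped_insertion id c (gapped_insertion tau m m) b xs.
Proof.
move=> ob.
pose T1 x y z := insertion tau (insertion id (m x) (c y)) (m z) xs.
pose T2 x y z := insertion tau (insertion tau (c x) (m y)) (m z) xs.
pose T3 x y z := insertion tau (m x) (insertion id (m y) (c z)) xs.
pose T4 x y z := insertion tau (m x) (insertion tau (c y) (m z)) xs.
pose T5 x y z := insertion id (insertion tau (m x) (m y)) (c z) xs.
pose T6 x y z := insertion id (c x) (insertion tau (m y) (m z)) xs.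
pose S T : C := \sum_(p <- decs G b) \sum_(q <- decs G p.2) T p.1 q.1 q.2.
have e12 : gapped_insertion tau (flow tau m c) m b xs = S T1 - S T2.
  rewrite /S -!(big_decs_assoc hG) -sumrB; apply: eq_bigr => p _.
  by rewrite insertion_subl !insertion_suml.
have e34 : gapped_insertion tau m (flow tau m c) b xs = S T3 - S T4.
  rewrite -sumrB; apply: eq_big_seq => p /(ok_decs ob)[k1 k2].
  by rewrite insertion_subr ?insertion_sumr //; exact: mm.
have e5 : gapped_insertion id (gapped_insertion tau m m) c b xs = S T5.
  rewrite /S -(big_decs_assoc hG); apply: eq_bigr => p _.
  by rewrite insertion_suml.
have e6 : gapped_insertion id c (gapped_insertion tau m m) b xs = S T6.
  by apply: eq_big_seq => p /(ok_decs ob)[k1 k2]; rewrite insertion_sumr //; exact: mc.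
rewrite {}e12 {}e34 {}e5 {}e6.
pose W1 x y z := insertion2 id tau (m x) (c y) (m z) xs.
pose W2 x y z := insertion2 tau id (m x) (m y) (c z) xs.
pose W3 x y z := insertion2 tau tau (c x) (m y) (m z) xs.
pose sw (T : R * int -> R * int -> R * int -> C) x y z := T x z y.
have Ssw T : S (sw T) = S T.
  by apply: eq_bigr => p _; rewrite (big_decs_swap hG (sw T p.1)).
have SD T T' : S (fun x y z => T x y z + T' x y z) = S T + S T'.
  by rewrite -big_split; apply: eq_bigr => p _; rewrite big_split.
have SB T T' : S (fun x y z => T x y z - T' x y z) = S T - S T'.
  by rewrite -sumrB; apply: eq_bigr => p _; rewrite sumrB.
have Seq T T' : (forall x y z, ok x -> ok y -> ok z -> T x y z = T' x y z) ->
    S T = S T'.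
  move=> TT; apply: eq_big_seq => p /(ok_decs ob)[k1 k2].
  by apply: eq_big_seq => q /(ok_decs k2)[k3 k4]; exact: TT.
(* The remainders of (m o c) o m and (m o m) o c agree once the last two indices are exchanged under
   the sum; that of (c o m) o m cancels against itself. *)
have -> : S T1 = S T4 + (S W1 + S W2).
  rewrite -[S W2]Ssw -!SD; apply: Seq => x y z ox oy oz.
  by rewrite /T1 /T4 /sw /W1 /W2; have [-> _ _] := insertion_flow_term xs ox oy oz.
have -> : S T5 = S T3 + (S W1 + S W2).
  rewrite -[S W1]Ssw -!SD; apply: Seq => x y z ox oy oz.
  by rewrite /T5 /T3 /sw /W1 /W2; have [_ -> _] := insertion_flow_term xs ox oy oz.
have -> : S T2 = S T6 + (S W3 - S W3).
  rewrite -[X in _ - X]Ssw -SB -SD; apply: Seq => x y z ox oy oz.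
  by rewrite /T2 /T6 /sw /W3; have [_ _ ->] := insertion_flow_term xs ox oy oz.
by rewrite subrr addr0 addrC -!addrA addKr.
Qed.

End Identity.
End GappedInsertion.

(** * Operations vanishing on the unit *)

Section Unit.
Variables (R : realType) (C : gradedSpace R) (e : C).
Implicit Types (f g : seq C -> C) (xs ys : seq C).

Definition vanishes_on f := forall xs ys, f (xs ++ e :: ys) = 0.

Lemma insertion_vanishes s f g xs ys : s e = e \/ s e = - e ->
  multilinear_op f -> vanishes_on f -> vanishes_on g ->
  insertion s f g (xs ++ e :: ys) = 0.
Proof.
move=> se mf fe ge; rewrite insertion_cat.
rewrite big1 ?add0r; last first.
  by move=> p _; apply: big1 => q _; rewrite -cat_cons catA; exact: fe.
rewrite big1 ?add0r; last first.
  by move=> p _; apply: big1 => q _; rewrite ge multilinear_op0.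
apply: big1 => p _; apply: big1 => q _.
by case: se => ->; rewrite ?fe // -scaleN1r multilinear_opZ // fe scaler0.
Qed.

End Unit.

(** * Construction of the extension *)

Section OperationPaths.
Variables (R : realType) (C : gradedSpace R).
Implicit Types (f g df dg : R -> seq C -> C).

Notation I01 t := (t \in `[(0 : R), 1]).

Definition has_path_derivatives f df : Prop :=
  forall xs, path_derivative (fun t => f t xs) (fun t => df t xs).

Lemma path_derivative_sum_in (V : lmodType R) (I : eqType) (r : seq I)
    (F f : I -> R -> V) :
  (forall i, i \in r -> path_derivative (F i) (f i)) ->
  path_derivative (fun t => \sum_(i <- r) F i t) (fun t => \sum_(i <- r) f i t).
Proof.
move=> h; pose K (H : I -> R -> V) i t := if i \in r then H i t else 0.
have /(path_derivative_sum r) : forall i, path_derivative (K F i) (K f i).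
  by rewrite /K => i; case: (i \in r) (h i) => [hi|_]; [exact: hi|exact: path_derivative_cst].
by apply: path_derivative_eq => t _; apply: eq_big_seq => i ir; rewrite /K ir.
Qed.

(** By linearity of [Phi t] both sides differentiate the same path, and derivatives are unique on
    [0,1]. *)
Lemma path_derivative_linear_in (V W : lmodType R) (Phi dPhi : R -> V -> W) :
  (forall t, I01 t -> linear (Phi t)) ->
  (forall x, path_derivative (fun t => Phi t x) (fun t => dPhi t x)) ->
  forall t, I01 t -> linear (dPhi t).
Proof.
move=> lP hP t t01 a x y.
have h := path_derivativeD (path_derivativeZ a (hP x)) (hP y).
apply: (path_derivative_unique (g := fun t => a *: dPhi t x + dPhi t y)
  (hP (a *: x + y)) _ t01).
by apply: path_derivative_eq h => // z z01; rewrite lP.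
Qed.

Lemma multilinear_derivative f df : (forall t, I01 t -> multilinear_op (f t)) ->
  has_path_derivatives f df -> forall t, I01 t -> multilinear_op (df t).
Proof.
move=> mf hf t t01 xs ys.
apply: (path_derivative_linear_in (Phi := fun t x => f t (xs ++ x :: ys))
  (dPhi := fun t x => df t (xs ++ x :: ys))) t01.
  by move=> z z01; exact: mf.
by move=> x; exact: hf.
Qed.

Lemma insertion_path_derivative s f df g dg :
  (forall t, I01 t -> multilinear_op (f t)) ->
  has_path_derivatives f df -> has_path_derivatives g dg ->
  has_path_derivatives (fun t => insertion s (f t) (g t))
    (fun t xs => insertion s (df t) (g t) xs + insertion s (f t) (dg t) xs).
Proof.
move=> mf hf hg xs.
pose F u v w t := f t (map s u ++ g t v :: w).
pose dF u v w t := df t (map s u ++ g t v :: w) + f t (map s u ++ dg t v :: w).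
have h u v w : path_derivative (F u v w) (dF u v w).
  apply: (path_derivative_apply
    (Phi := fun t x => f t (map s u ++ x :: w))
    (dPhi := fun t x => df t (map s u ++ x :: w))).
  - by move=> t t01; exact: mf.
  - by move=> t t01; exact: (multilinear_derivative mf hf).
  - by move=> x; exact: hf.
  - exact: hg.
have := path_derivative_sum (splits xs) (fun p => path_derivative_sum (splits p.2)
   (fun q => h p.1 q.1 q.2)).
apply: path_derivative_eq => t _ //.
rewrite -big_split; apply: eq_bigr => p _.
by rewrite -big_split.
Qed.

Lemma smooth_path_insertion s f g :
  (forall t, I01 t -> multilinear_op (f t)) ->
  (forall xs, smooth_path (fun t => f t xs)) ->
  (forall xs, smooth_path (fun t => g t xs)) ->
  forall xs, smooth_path (fun t => insertion s (f t) (g t) xs).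
Proof.
have ex h : (forall xs, smooth_path (fun t => h t xs)) ->
    exists dh, has_path_derivatives h dh.
  move=> sh.
  have /choice[dh hdh] xs := (smooth_pathP _).1 (sh xs).
  by exists (fun t xs => dh xs t).
move=> mf /ex[df hf] /ex[dg hg] xs.
exact: path_derivative_smooth (insertion_path_derivative s mf hf hg xs).
Qed.

(** Made total by the default 0, so that the recursion can be written down before its integrand is
    known to be smooth. *)
Definition antiderivative (V : lmodType R) (f : R -> V) (v : V) : R -> V :=
  if pselect (exists2 F, path_derivative F f & F 1 = v) is left h
  then sval (cid2 h) else fun=> 0.

Lemma antiderivativeP (V : lmodType R) (f : R -> V) (v : V) : smooth_path f ->
  path_derivative (antiderivative f v) f /\ antiderivative f v 1 = v.
Proof.
move=> /(smooth_path_antiderivative v) h; rewrite /antiderivative.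
by case: pselect => // h'; case: (cid2 h').
Qed.

End OperationPaths.

(** Recursion on fuel: the result no longer changes once the fuel exceeds the rank, so [(rk b).+1]
    units are enough at b. *)
Lemma measure_recursion (B X : Type) (rk : B -> nat) (x0 : X)
    (Phi : B -> (B -> X) -> X) :
  exists M : B -> X, forall b,
    M b = Phi b (fun b' => if (rk b' < rk b)%N then M b' else x0).
Proof.
pose N := fix N n b := if n is n'.+1 then
  Phi b (fun b' => if (rk b' < rk b)%N then N n' b' else x0) else x0.
have stable n k b : (rk b < n)%N -> (rk b < k)%N -> N n b = N k b.
  elim: n k b => [//|n IH] [//|k] b bn bk /=.
  congr Phi; apply/funext => b'; case: ifP => // lt.
  by apply: IH; apply: leq_trans lt _; rewrite -ltnS.
exists (fun b => N (rk b).+1 b) => b; rewrite [LHS]/=.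
congr Phi; apply/funext => b'; case: ifP => // lt.
exact: stable.
Qed.

(** * The extended operations and their properties *)

Section Extension.
Variables (R : realType) (G : set (R * int)) (C : gradedSpace R) (n : int)
  (pair : C -> C -> R) (E0 E1 : R) (m0 m1 : operations C)
  (mt ct : R -> operations C).
Hypotheses (hG : discrete_submonoid G)
  (hm0 : cyclic_Ainfty_mod G n pair E0 m0)
  (hm1 : cyclic_Ainfty_mod G n pair E1 m1)
  (hpi : pseudo_isotopy_mod G n pair E0 mt ct)
  (hjoin : joins_mod G E0 mt m0 m1).
Variable tau : C -> C.
Hypotheses (tau_lin : linear tau)
  (tauE : forall d x, shifted C d x -> tau x = psign R d *: x).

Notation I01 t := (t \in `[(0 : R), 1]).
Notation rk := (rank G).

Definition truncated (t : R) : operations C :=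
  fun b => if b.1 < E0 then ct t b else fun=> 0.

Definition below b (m : operations C) : operations C :=
  fun b' => if (rk b' < rk b)%N then m b' else fun=> 0.

(* [below b] cuts [flow] down to the operations already constructed; by
   [flow_below] this removes only zero terms. *)
Lemma extension_exists : exists M : R -> operations C, forall b t xs,
  M t b xs = if b.1 < E0 then mt t b xs else
    antiderivative (fun s => flow G tau (below b (M s)) (truncated s) b xs)
      (m1 b xs) t.
Proof.
pose Phi b (H : R * int -> R -> seq C -> C) := if b.1 < E0 then mt^~ b
  else fun t xs =>
    antiderivative (fun s => flow G tau (H^~ s) (truncated s) b xs) (m1 b xs) t.
have [M hM] := measure_recursion rk (fun _ _ => 0) Phi.
exists (fun t b => M b t) => b t xs; rewrite hM /Phi; case: ifP => // _.
congr antiderivative; apply/funext => s; congr flow; apply/funext => b'.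
by rewrite /below; case: ifP.
Qed.

Variable M : R -> operations C.
Hypothesis ME : forall b t xs,
  M t b xs = if b.1 < E0 then mt t b xs else
    antiderivative (fun s => flow G tau (below b (M s)) (truncated s) b xs)
      (m1 b xs) t.

Lemma tau_twist : koszul_twist tau 1.
Proof. by split=> // d x /tauE; rewrite mul1r. Qed.

Let ok b := G b /\ b.1 < E1.

Lemma ok_decs b p : ok b -> p \in decs G b -> ok p.1 /\ ok p.2.
Proof.
move=> [_ b1] pb; have [e1 e2] := decs_energy hG pb.
have /(decsP hG)[g1 g2 _] := pb.
by split; split=> //; apply: le_lt_trans b1.
Qed.

Lemma low_decs b p : b.1 < E0 -> p \in decs G b -> p.1.1 < E0 /\ p.2.1 < E0.
Proof.
move=> b1 pb; have [e1 e2] := decs_energy hG pb.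
by split; apply: le_lt_trans b1.
Qed.

(** Energies below E0 carry given data and form the base case whatever their rank; the others are
    reached by induction on the rank. *)
Lemma ok_ind (P : R * int -> Prop) :
  (forall b, ok b -> b.1 < E0 -> P b) ->
  (forall b, ok b -> E0 <= b.1 ->
     (forall b', ok b' -> (rk b' < rk b)%N -> P b') -> P b) ->
  forall b, ok b -> P b.
Proof.
move=> h1 h2 b; have [k] := ubnP (rk b); elim: k b => // k IH b bk ob.
have [lt|ge] := ltP b.1 E0; first exact: h1.
apply: h2 => // b' ob' lt; apply: IH => //.
by apply: leq_trans lt _; rewrite -ltnS.
Qed.

Lemma M_low t b : b.1 < E0 -> M t b = mt t b.
Proof. by move=> lt; apply/funext => xs; rewrite ME lt. Qed.

Lemma truncated_low t b : b.1 < E0 -> truncated t b = ct t b.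
Proof. by rewrite /truncated => ->. Qed.

Lemma truncated_high t b : E0 <= b.1 -> truncated t b = fun=> 0.
Proof. by rewrite /truncated ltNge => ->. Qed.

Lemma truncated0 t : I01 t -> truncated t 0 = fun=> 0.
Proof.
move=> t01; rewrite /truncated; case: ifP => // E0_gt0.
by apply/funext => xs; exact: (pi_c_zero hpi E0_gt0 t01).
Qed.

Lemma zero_multilinear : multilinear_op (fun=> 0 : C).
Proof. by move=> xs ys a x y; rewrite scaler0 addr0. Qed.

Lemma zero_degree r : has_degree (fun=> 0 : C) r.
Proof. by move=> ds xs _; exact: gr_zero. Qed.

Lemma truncated_multilinear t b : I01 t -> ok b -> multilinear_op (truncated t b).
Proof.
move=> t01 [Gb _]; rewrite /truncated; case: ifP => [lt|_].
  exact: (pi_c_multilinear hpi).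
exact: zero_multilinear.
Qed.

Lemma truncated_degree t b : I01 t -> ok b -> has_degree (truncated t b) (- b.2).
Proof.
move=> t01 [Gb _]; rewrite /truncated; case: ifP => [lt|_].
  exact: (pi_c_degree hpi).
exact: zero_degree.
Qed.

Lemma truncated_smooth b xs : ok b -> smooth_path (fun t => truncated t b xs).
Proof.
move=> [Gb _]; have [lt|ge] := ltP b.1 E0.
  apply: (smooth_path_eq (F := fun t => ct t b xs)).
    by move=> t _; rewrite truncated_low.
  exact: (pi_c_smooth hpi).
apply: (smooth_path_eq (F := fun=> 0)).
  by move=> t _; rewrite truncated_high.
exact: path_derivative_smooth (path_derivative_cst (0 : C)).
Qed.

Lemma truncated_cyclic t b : I01 t -> ok b -> cyclic_symmetric pair (truncated t b).
Proof.
move=> t01 [Gb _]; rewrite /truncated; case: ifP => [lt|_].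
  exact: (pi_c_cyclic hpi).
move=> d0 x0 ds xs dk xk _ _ _.
by rewrite !(pair0l (ainf_pairing hm0)) mulr0.
Qed.

(** In a dropped term m sits at a rank not below that of b, so c sits at (0,0) and is zero.
    Multilinearity of M at b makes the insertion of this zero into it vanish. *)
Lemma flow_below b t xs : ok b -> I01 t -> multilinear_op (M t b) ->
  flow G tau (below b (M t)) (truncated t) b xs = flow G tau (M t) (truncated t) b xs.
Proof.
move=> ob t01 mM; congr (_ - _); apply: eq_big_seq => p pb; rewrite /below.
  case: ifP => // /negP lt.
  have p2 : p.2 = 0 by apply/eqP; apply: contrapT => /negP /(rank_lt hG pb).
  have p1 : p.1 = b by have /(decsP hG)[_ _ <-] := pb; rewrite p2 addr0.
  by rewrite p2 p1 truncated0 // insertion_0l insertion_0r.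
case: ifP => // /negP lt.
have p1 : p.1 = 0 by apply/eqP; apply: contrapT => /negP /(rank_lt2 hG pb).
by rewrite p1 truncated0 // !insertion_0l.
Qed.

(** Below E0 this is the given equation, extended from homogeneous inputs. Above, M is first the
    integral of the flow cut by [below]; its multilinearity follows from that of the integrand and
    of m^1, and only then can the cut be removed. *)
Lemma M_flow b : ok b ->
  [/\ forall t, I01 t -> multilinear_op (M t b),
      has_path_derivatives (M^~ b) (fun t => flow G tau (M t) (truncated t) b) &
      forall xs, M 1 b xs = m1 b xs].
Proof.
move: b; apply: ok_ind => b ob.
  move=> lt; have [Gb _] := ob.
  have mM b' t : G b' -> b'.1 < E0 -> I01 t -> multilinear_op (M t b').
    by move=> Gb' lt' t01; rewrite M_low //; exact: (ainf_multilinear (pi_Ainfty hpi t01)).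
  split; first by move=> t; exact: mM.
    have /choice[d hd] xs : exists d, path_derivative (fun t => M t b xs) d.
      apply/smooth_pathP; apply: (smooth_path_eq (F := fun t => mt t b xs)).
        by move=> t _; rewrite M_low.
      exact: (pi_m_smooth hpi).
    move=> xs; apply: path_derivative_eq (hd xs) => // t t01.
    apply: (@multilinear_op_ext _ _ (fun xs => d xs t)).
    - apply: (multilinear_derivative (f := M^~ b) (df := fun t xs => d xs t)) t01 => //.
      by move=> z; exact: mM.
    - apply: flow_multilinear => // p pb; have [lt1 _] := low_decs lt pb;
        have [k1 _] := ok_decs ob pb.
        exact: (mM p.1 t k1.1).
      exact: truncated_multilinear.
    move=> l /homl_has_degs hl.
    have [dm hdm /(_ t t01) e] := pi_equation hpi Gb lt hl.
    have -> : d (unzip1 l) t = dm t.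
      apply: (path_derivative_unique (hd (unzip1 l)) _ t01).
      by apply: path_derivative_eq hdm => // z _; rewrite M_low.
    have mct p : p \in decs G b -> multilinear_op (ct t p.1).
      move=> pb; have [lt1 _] := low_decs lt pb; have [k1 _] := ok_decs ob pb.
      exact: (pi_c_multilinear hpi t01 k1.1).
    move: e; rewrite insertion_sum1E // (@insertion_sum_koszulE _ _ _ hG tau) //;
      last exact: tau_twist.
    move=> /eqP; rewrite subr_eq0 addrC => /eqP e.
    rewrite /flow -[LHS](addKr (gapped_insertion G tau (ct t) (mt t) b (unzip1 l))) e.
    rewrite addrC; congr (_ - _); apply: eq_gapped_insertion => p pb;
      have [lt1 lt2] := low_decs lt pb; by rewrite ?M_low ?truncated_low.
  by move=> xs; rewrite M_low //; have [_ ->] := hjoin Gb lt xs.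
move=> ge IH.
have Nb : (b.1 < E0) = false by rewrite ltNge ge.
have below_prop p : ok p ->
    (forall t, I01 t -> multilinear_op (below b (M t) p)) /\
    forall xs, smooth_path (fun t => below b (M t) p xs).
  move=> k1; rewrite /below; case: (rk p < rk b)%N (IH _ k1) => [/(_ isT)[h1 h2 _]|_].
    by split=> // xs; exact: path_derivative_smooth (h2 xs).
  split=> [t _|xs]; first exact: zero_multilinear.
  exact: path_derivative_smooth (path_derivative_cst (0 : C)).
pose f s xs := flow G tau (below b (M s)) (truncated s) b xs.
have mf t : I01 t -> multilinear_op (f t).
  move=> t01; apply: flow_multilinear => // p pb; have [k1 _] := ok_decs ob pb.
    exact: (below_prop _ k1).1.
  exact: truncated_multilinear.
have sf xs : smooth_path (fun s => f s xs).
  have sp s h h' (hh : forall p, p \in decs G b ->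
      [/\ forall t, I01 t -> multilinear_op (h t p.1),
       forall xs, smooth_path (fun t => h t p.1 xs) &
       forall xs, smooth_path (fun t => h' t p.2 xs)]) :
     exists d, path_derivative (fun t => gapped_insertion G s (h t) (h' t) b xs) d.
    have hex p : exists d, p \in decs G b ->
        path_derivative (fun t => insertion s (h t p.1) (h' t p.2) xs) d.
      have [/hh[h1 h2 h3]|] := boolP (p \in decs G b).
        have := smooth_path_insertion s h1 h2 h3 xs.
        by move=> /smooth_pathP[d hd]; exists d.
      by exists (fun=> 0).
    have /choice[d hd] := hex.
    by exists (fun t => \sum_(p <- decs G b) d p t); apply: path_derivative_sum_in.
  have [|d1 hd1] := sp id (fun t => below b (M t)) truncated.
    move=> p pb; have [k1 k2] := ok_decs ob pb; have [h1 h2] := below_prop _ k1.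
    by split=> // ys; exact: truncated_smooth.
  have [|d2 hd2] := sp tau truncated (fun t => below b (M t)).
    move=> p pb; have [k1 k2] := ok_decs ob pb; have [h1 h2] := below_prop _ k2.
    split=> // [t t01|ys]; [exact: truncated_multilinear|exact: truncated_smooth].
  exact: path_derivative_smooth (path_derivativeD hd1 (path_derivativeN hd2)).
have PM xs : path_derivative (fun t => M t b xs) (fun t => f t xs) /\ M 1 b xs = m1 b xs.
  have [h1 h2] := antiderivativeP (m1 b xs) (sf xs).
  split; last by rewrite ME Nb.
  by apply: path_derivative_eq h1 => // t _; rewrite ME Nb.
have mM t : I01 t -> multilinear_op (M t b).
  move=> t01 xs ys a x y; apply/eqP; rewrite -subr_eq0; apply/eqP.
  (* The defect of linearity has zero derivative and vanishes at t = 1. *)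
  pose z t := M t b (xs ++ (a *: x + y) :: ys) -
    (a *: M t b (xs ++ x :: ys) + M t b (xs ++ y :: ys)).
  rewrite -/(z t) (_ : z t = z 1).
    rewrite /z !(PM _).2 (ainf_multilinear hm1 ob.1 ob.2) subrr; done.
  have h := path_derivativeD (PM (xs ++ (a *: x + y) :: ys)).1 (path_derivativeN
    (path_derivativeD (path_derivativeZ a (PM (xs ++ x :: ys)).1)
      (PM (xs ++ y :: ys)).1)).
  apply: (path_derivative0_cst h _ t01 (in01_1 R)) => s s01.
  by rewrite mf // subrr.
split=> // [xs|xs]; last exact: (PM xs).2.
apply: path_derivative_eq (PM xs).1 => // t t01.
by apply: flow_below => //; exact: mM.
Qed.

(** Evenness of mu enters here: every m_beta is odd and every c_beta even, so the twists [tau] and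
    [id] serve all beta. *)
Lemma psign_maslov b : G b -> psign R (- b.2) = 1 /\ psign R (1 - b.2) = -1.
Proof.
move=> /(dsm_maslov_even hG)/dvdzP[q ->].
by rewrite psignD psignN psign_even psign1 mulr1.
Qed.

Lemma id_twist b : G b -> koszul_twist (@id C) (- b.2).
Proof. by move=> /psign_maslov[h _]; exact: koszul_twist_id. Qed.

Lemma odd_twist b : G b -> koszul_twist tau (1 - b.2).
Proof.
move=> /psign_maslov[_ h]; split=> // d x /tauE ->.
by rewrite [in RHS]/psign -exprz_exp -/(psign R _) h.
Qed.

Lemma tauK : involutive tau.
Proof.
apply: (linear_ext_hom (f := fun x => tau (tau x)) (g := id)) => //.
  by move=> a x y; rewrite !tau_lin.
move=> d x hx; have tl a y : tau (a *: y) = a *: tau y.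
  have t0 : tau 0 = 0.
    have := tau_lin 1 0 0; rewrite !scale1r addr0 => /eqP.
    by rewrite -subr_eq0 opprD addNKr oppr_eq0 => /eqP.
  by have := tau_lin a y 0; rewrite t0 !addr0.
by rewrite (tauE hx) tl (tauE hx) scalerA psign_sqr scale1r.
Qed.

Section FlowProperties.
Variables (m c : operations C).
Hypotheses (mm : forall b, ok b -> multilinear_op (m b))
  (mc : forall b, ok b -> multilinear_op (c b))
  (dm : forall b, ok b -> has_degree (m b) (1 - b.2))
  (dc : forall b, ok b -> has_degree (c b) (- b.2)).

Lemma flow_degree b : ok b -> has_degree (flow G tau m c b) (1 - b.2).
Proof.
move=> ob ds xs h.
have sum_shifted r (F : (R * int) * (R * int) -> C) :
    (forall p, p \in decs G b -> shifted C r (F p)) ->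
    shifted C r (\sum_(p <- decs G b) F p).
  move=> hF; rewrite big_seq; elim/big_ind: _ => //; first exact: gr_zero.
  by move=> x y hx hy; rewrite -[x]scale1r; exact: gr_lin.
rewrite /flow [X in shifted C _ X]addrC -scaleN1r; apply: gr_lin; apply: sum_shifted => p pb;
  have [k1 k2] := ok_decs ob pb; have /(decsP hG)[_ _ <-] := pb.
- have := insertion_degree (odd_twist k2.1) (mc k1) (dc k1) (dm k2) h.
  by rewrite /=; congr (shifted C _ _); ring.
- have := insertion_degree (id_twist k2.1) (mm k1) (dm k1) (dc k2) h.
  by rewrite /=; congr (shifted C _ _); ring.
Qed.

Lemma flow_cyclic b : ok b ->
  (forall b, ok b -> cyclic_symmetric pair (m b)) ->
  (forall b, ok b -> cyclic_symmetric pair (c b)) ->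
  cyclic_symmetric pair (flow G tau m c b).
Proof.
move=> ob cm cc d0 x0 ds xs dk xk h0 hxs hk.
have hp := ainf_pairing hm0.
(* Exchanging the two components of the decompositions in the second sum pairs each m o c with its c
   o m, so every summand is a commutator. *)
have E ys : flow G tau m c b ys = \sum_(p <- decs G b)
    (insertion id (m p.1) (c p.2) ys - insertion tau (c p.2) (m p.1) ys).
  rewrite /flow /gapped_insertion.
  by rewrite (big_decs_swap hG (fun x y => insertion tau (c x) (m y) ys)) -sumrB.
rewrite !E !(pair_suml hp) mulr_sumr; apply: eq_big_seq => p pb.
have [k1 k2] := ok_decs ob pb.
apply: (insertion_commutator_cyclic hp (mm k1) (mc k2) (cm _ k1) (cc _ k2)
  (dm k1) (dc k2) (odd_twist k1.1) (id_twist k2.1) _ h0 hxs hk).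
have [e _] := psign_maslov k2.1.
by rewrite /psign mulrC -exprz_exp -/(psign R _) e exp1rz.
Qed.

End FlowProperties.

Lemma below_ok b (P : R * int -> (seq C -> C) -> Prop) (m : operations C) :
  (forall b', ok b' -> P b' (fun=> 0)) ->
  (forall b', ok b' -> (rk b' < rk b)%N -> P b' (m b')) ->
  forall b', ok b' -> P b' (below b m b').
Proof. by move=> P0 Pm b' ob'; rewrite /below; case: ifP => [lt|_]; auto. Qed.

Lemma M_multilinear t b : I01 t -> ok b -> multilinear_op (M t b).
Proof. by move=> t01 /M_flow[h _ _]; exact: h. Qed.

Lemma below_multilinear t b b' : I01 t -> ok b' ->
  multilinear_op (below b (M t) b').
Proof.
move=> t01; apply: (below_ok (P := fun _ f => multilinear_op f)) => *.
  exact: zero_multilinear.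
exact: M_multilinear.
Qed.

Lemma flow_belowE b t xs : ok b -> I01 t ->
  flow G tau (M t) (truncated t) b xs = flow G tau (below b (M t)) (truncated t) b xs.
Proof. by move=> ob t01; rewrite flow_below //; exact: M_multilinear. Qed.

Lemma M_degree b : ok b -> forall t, I01 t -> has_degree (M t b) (1 - b.2).
Proof.
move: b; apply: ok_ind => b ob.
  by move=> lt t t01; rewrite M_low //; exact: (ainf_degree (pi_Ainfty hpi t01) ob.1).
move=> ge IH t t01 ds xs h; have [_ hM M1] := M_flow ob.
pose S := shifted C (\sum_(d <- ds) d + (1 - b.2)).
apply: (path_derivative_subspace (S := S) _ _ (hM xs)) => //.
- exact: gr_zero.
- by move=> a x y; exact: gr_lin.
- move=> s s01; rewrite flow_belowE //; apply: flow_degree => // b' ob'.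
  + exact: below_multilinear.
  + exact: truncated_multilinear.
  + apply: (below_ok (P := fun b' f => has_degree f (1 - b'.2))) ob' => b'' *.
      exact: zero_degree.
    exact: IH.
  + exact: truncated_degree.
- by rewrite M1; exact: (ainf_degree hm1 ob.1 ob.2).
Qed.

Lemma zero_cyclic : cyclic_symmetric pair (fun=> 0 : C).
Proof.
by move=> d0 x0 ds xs dk xk _ _ _; rewrite !(pair0l (ainf_pairing hm0)) mulr0.
Qed.

Lemma M_cyclic b : ok b -> forall t, I01 t -> cyclic_symmetric pair (M t b).
Proof.
have hp := ainf_pairing hm0.
move: b; apply: ok_ind => b ob.
  by move=> lt t t01; rewrite M_low //; exact: (ainf_cyclic (pi_Ainfty hpi t01) ob.1).
move=> ge IH t t01 d0 x0 ds xs dk xk h0 hxs hk; have [_ hM M1] := M_flow ob.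
(* With the line seen as the module [R^o], the defect of cyclicity is itself a path, whose
   derivative is the defect of the flow. *)
set k := (-1) ^ _; pose L z (x : C) : R^o := pair x z.
have lL z : linear (L z) by exact: (pair_linear_l hp z).
have h := path_derivativeD
  (path_derivative_linear (lL x0) (hM (rcons xs xk)))
  (path_derivativeN
    (path_derivativeZ k (path_derivative_linear (lL xk) (hM (x0 :: xs))))).
apply/eqP; rewrite -subr_eq0.
have := path_derivative0_cst h _ t01 (in01_1 R).
rewrite /L !M1 => ->.
  by rewrite (ainf_cyclic hm1 ob.1 ob.2 h0 hxs hk) subrr.
move=> s s01; rewrite !flow_belowE //; apply/eqP; rewrite subr_eq0; apply/eqP.
apply: (flow_cyclic _ _ _ _ ob _ _ h0 hxs hk) => b' ob'.
- exact: below_multilinear.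
- exact: truncated_multilinear.
- apply: (below_ok (P := fun b' f => has_degree f (1 - b'.2))) ob' => b'' *.
    exact: zero_degree.
  exact: M_degree.
- exact: truncated_degree.
- apply: (below_ok (P := fun _ f => cyclic_symmetric pair f)) ob' => b'' *.
    exact: zero_cyclic.
  exact: IH.
- exact: truncated_cyclic.
Qed.

(** The relation is wanted on all lists, because the induction has to replace a whole operation m o
    m by zero. *)
Lemma relation_all (E : R) (m : operations C) b : cyclic_Ainfty_mod G n pair E m ->
  G b -> b.1 < E -> forall xs, gapped_insertion G tau m m b xs = 0.
Proof.
move=> hm Gb bE.
have mm p : p \in decs G b -> multilinear_op (m p.1) /\ multilinear_op (m p.2).
  move=> pb; have [e1 e2] := decs_energy hG pb; have /(decsP hG)[g1 g2 _] := pb.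
  by split; apply: (ainf_multilinear hm) => //; apply: le_lt_trans bE.
apply: (multilinear_op_ext (g := fun=> 0)).
- by apply: gapped_insertion_multilinear => // p /mm[].
- exact: zero_multilinear.
move=> l /homl_has_degs hl.
have <- := ainf_relation hm Gb bE hl.
apply/esym/insertion_sum_koszulE => //; first exact: tau_twist.
by move=> p /mm[].
Qed.

Lemma M_relation b : ok b -> forall t, I01 t -> forall xs,
  gapped_insertion G tau (M t) (M t) b xs = 0.
Proof.
move: b; apply: ok_ind => b ob.
  move=> lt t t01 xs; rewrite -[RHS](relation_all (pi_Ainfty hpi t01) ob.1 lt xs).
  by apply: eq_gapped_insertion => p /(low_decs lt)[lt1 lt2]; rewrite M_low.
move=> ge IH t t01 xs.
pose Q t := gapped_insertion G tau (M t) (M t).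
pose f t := flow G tau (M t) (truncated t).
have hQ : path_derivative (fun t => Q t b xs)
    (fun t => gapped_insertion G tau (f t) (M t) b xs +
              gapped_insertion G tau (M t) (f t) b xs).
  have := @path_derivative_sum_in R C _ (decs G b)
    (fun p t => insertion tau (M t p.1) (M t p.2) xs)
    (fun p t => insertion tau (f t p.1) (M t p.2) xs +
                insertion tau (M t p.1) (f t p.2) xs).
  move=> h; apply: path_derivative_eq (h _) => [//|z _|p pb].
    by rewrite big_split.
  have [k1 k2] := ok_decs ob pb.
  have [h1 h2 _] := M_flow k1; have [_ h3 _] := M_flow k2.
  exact: insertion_path_derivative.
rewrite -/(Q t b xs) (path_derivative0_cst hQ _ t01 (in01_1 R)).
  rewrite -[RHS](relation_all hm1 ob.1 ob.2 xs).
  apply: eq_gapped_insertion => p /(ok_decs ob)[k1 k2].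
    by have [_ _] := M_flow k1.
  by have [_ _] := M_flow k2.
move=> s s01.
rewrite (gapped_insertion_flow hG (ok := ok) tauK ok_decs _ _ _ _ xs ob).
- have mQ b' : ok b' -> multilinear_op (Q s b').
    move=> ob'; apply: gapped_insertion_multilinear => // p /(ok_decs ob')[k1 k2];
    exact: M_multilinear.
  (* Each term vanishes: either c has index (0,0) and is zero, or [Q] has smaller rank and is zero
     by induction. *)
  rewrite !gapped_insertion_eq0 ?subrr // => p pb; have [k1 k2] := ok_decs ob pb.
    have [p1|p1] := eqVneq p.1 0; first by rewrite p1 truncated0 // insertion_0l.
    rewrite (_ : gapped_insertion G tau (M s) (M s) p.2 = fun=> 0).
      by rewrite insertion_0r //; exact: truncated_multilinear.
    by apply/funext => ys; apply: IH => //; exact: rank_lt2.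
  have [p2|p2] := eqVneq p.2 0.
    by rewrite p2 truncated0 // insertion_0r //; exact: mQ.
  rewrite (_ : gapped_insertion G tau (M s) (M s) p.1 = fun=> 0).
    by rewrite insertion_0l.
  by apply/funext => ys; apply: IH => //; exact: rank_lt.
- by move=> b'; exact: M_multilinear.
- by move=> b'; exact: truncated_multilinear.
- move=> b' ob' ys; have [_ e] := psign_maslov ob'.1.
  rewrite (op_twist (M_multilinear s01 ob') tau_lin (M_degree ob' s01) tauE) e.
  by rewrite scaleN1r.
- move=> b' ob' ys; have [e _] := psign_maslov ob'.1.
  rewrite (op_twist (truncated_multilinear s01 ob') tau_lin
    (truncated_degree s01 ob') tauE) e.
  by rewrite scale1r.
Qed.

Lemma ok0 : 0 < E1 -> ok 0.
Proof. by split=> //; exact: dsm_zero hG. Qed.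

(** Energies in G are nonnegative, so for E0 <= 0 the given pseudo-isotopy prescribes no operation:
    the extended c is zero and the flow stands still. *)
Lemma M_const t b xs : E0 <= 0 -> ok b -> I01 t -> M t b xs = m1 b xs.
Proof.
move=> E00 ob t01; have [_ hM M1] := M_flow ob.
rewrite -M1; apply: (path_derivative0_cst (hM xs)) (t01) (in01_1 R) => s s01.
have tr p : ok p -> truncated s p = fun=> 0.
  move=> [Gp _]; apply: truncated_high.
  exact: le_trans E00 (dsm_energy_ge0 hG Gp).
rewrite /flow /gapped_insertion !big1_seq ?subrr // => p /andP[_ /(ok_decs ob)[k1 k2]].
  by rewrite tr // insertion_0l.
by rewrite tr // insertion_0r //; exact: M_multilinear.
Qed.

(** The conditions on m_{k,(0,0)} alone are inherited from whichever structure supplies these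
    operations. *)
Lemma M_zero t : 0 < E1 -> I01 t ->
  (exists2 m : operations C, cyclic_Ainfty_mod G n pair E1 m & M t 0 = m 0) \/
  (0 < E0 /\ M t 0 = mt t 0).
Proof.
move=> E1_gt0 t01; have [E00|E0_gt0] := leP E0 0; last first.
  by right; split=> //; exact: M_low.
by left; exists m1 => //; apply/funext => xs; exact: M_const (ok0 E1_gt0) t01.
Qed.

Lemma M_Ainfty t : I01 t -> cyclic_Ainfty_mod G n pair E1 (M t).
Proof.
move=> t01; split.
- exact: ainf_pairing hm0.
- by move=> b Gb bE; exact: M_multilinear.
- by move=> b Gb bE; exact: M_degree.
- move=> E1_gt0; have [[m hm ->]|[E0_gt0 ->]] := M_zero E1_gt0 t01.
    exact: ainf_m0 hm E1_gt0.
  exact: ainf_m0 (pi_Ainfty hpi t01) E0_gt0.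
- move=> b Gb bE ds xs h.
  rewrite (@insertion_sum_koszulE _ _ _ hG tau) //; last 2 first.
  + exact: tau_twist.
  + by move=> p /(ok_decs (conj Gb bE))[k1 _]; exact: M_multilinear.
  exact: M_relation.
- by move=> b Gb bE; exact: M_cyclic.
- move=> E1_gt0; have [[m hm ->]|[E0_gt0 ->]] := M_zero E1_gt0 t01.
    exact: ainf_perfect hm E1_gt0.
  exact: ainf_perfect (pi_Ainfty hpi t01) E0_gt0.
Qed.

Lemma extension_pseudo_isotopy : pseudo_isotopy_mod G n pair E1 M truncated.
Proof.
split.
- by move=> t t01 b Gb bE; exact: truncated_multilinear.
- by move=> t t01 b Gb bE; exact: truncated_degree.
- move=> b Gb bE xs; have [_ hM _] := M_flow (conj Gb bE).
  exact: path_derivative_smooth (hM xs).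
- by move=> b Gb bE xs; exact: truncated_smooth.
- exact: M_Ainfty.
- by move=> t t01 b Gb bE; exact: truncated_cyclic.
- move=> b Gb bE ds xs h; have [_ hM _] := M_flow (conj Gb bE).
  exists (fun t => flow G tau (M t) (truncated t) b xs); first exact: hM.
  move=> t t01; rewrite insertion_sum1E // (@insertion_sum_koszulE _ _ _ hG tau) //.
  + by rewrite /flow subrK subrr.
  + exact: tau_twist.
  + by move=> p /(ok_decs (conj Gb bE))[k1 _]; exact: truncated_multilinear.
- move=> E1_gt0 s t s01 t01 xs; have [E00|E0_gt0] := leP E0 0.
    by rewrite !M_const //; exact: ok0.
  by rewrite !M_low //; exact: (pi_m_const hpi).
- by move=> _ t t01 xs; rewrite truncated0.
Qed.

Lemma extension_joins : joins_mod G E1 M (M 0) m1.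
Proof. by move=> b Gb bE xs; have [_ _ h] := M_flow (conj Gb bE). Qed.

Lemma extension_extends t : extends_mod G E0 (mt t) (M t) /\
  extends_mod G E0 (ct t) (truncated t).
Proof.
by split=> b Gb lt xs; [rewrite M_low|rewrite truncated_low].
Qed.

Lemma extension_extends0 : extends_mod G E0 m0 (M 0).
Proof. by move=> b Gb lt xs; rewrite M_low //; have [-> _] := hjoin Gb lt xs. Qed.

(** * The unital version *)

Section Unital.
Variable e : C.
Hypotheses (he1 : is_unit_mod G E1 m1 e)
  (hu : unital_pseudo_isotopy_mod G E0 mt ct e).

Lemma truncated_vanishes t b : I01 t -> ok b -> vanishes_on e (truncated t b).
Proof.
move=> t01 [Gb _] xs ys; rewrite /truncated; case: ifP => // lt.
exact: (hu t01).2.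
Qed.

Lemma tau_unit : tau e = - e.
Proof.
rewrite (tauE (d := -1)); first by rewrite psignN psign1 scaleN1r.
by rewrite /shifted addNr; exact: unit_deg he1.
Qed.

(** The exceptional m_{2,(0,0)} meets only c at b itself, which is zero above E0; all other
    operations in the flow vanish on e, so no cancellation is involved. *)
Lemma M_vanishes b : ok b -> forall t, I01 t -> forall xs ys,
  ~ (size (xs ++ e :: ys) = 2%N /\ b = 0) -> M t b (xs ++ e :: ys) = 0.
Proof.
move: b; apply: ok_ind => b ob.
  move=> lt t t01 xs ys h; rewrite M_low //.
  exact: (unit_vanish (hu t01).1 ob.1).
move=> ge IH t t01 xs ys h; have [_ hM M1] := M_flow ob.
rewrite (path_derivative0_cst (hM _) _ t01 (in01_1 R)).
  by rewrite M1; exact: (unit_vanish he1 ob.1 ob.2).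
move=> s s01; rewrite flow_belowE //.
have trb : truncated s b = fun=> 0 by exact: truncated_high.
have bv p : ok p -> p != 0 -> vanishes_on e (below b (M s) p).
  move=> k p0; apply: (below_ok (P := fun p f => p != 0 -> vanishes_on e f)) k p0 => //.
  move=> b' ob' lt b0 us vs; apply: IH => // -[_ b'0].
  by move: b0; rewrite b'0 eqxx.
rewrite /flow /gapped_insertion !big1_seq ?subrr // => p /andP[_ pb];
  have [k1 k2] := ok_decs ob pb; have /(decsP hG)[_ _ eb] := pb.
  have [p0|p0] := eqVneq p.2 0.
    by rewrite (_ : p.1 = b) ?trb ?insertion_0l // -eb p0 addr0.
  apply: insertion_vanishes; first by right; exact: tau_unit.
  - exact: truncated_multilinear.
  - exact: truncated_vanishes.
  - exact: bv.
have [p0|p0] := eqVneq p.1 0.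
  have -> : p.2 = b by rewrite -eb p0 add0r.
  by rewrite trb insertion_0r //; exact: below_multilinear.
apply: insertion_vanishes; first by left.
- exact: below_multilinear.
- exact: bv.
- exact: truncated_vanishes.
Qed.

Lemma M_unit t : I01 t -> is_unit_mod G E1 (M t) e.
Proof.
move=> t01; split.
- exact: unit_deg he1.
- move=> E1_gt0 d x hx; have [E00|E0_gt0] := leP E0 0.
    by rewrite !M_const //; [exact: (unit_m2 he1)|exact: ok0..].
  by rewrite M_low //; exact: (unit_m2 (hu t01).1).
- by move=> b Gb bE xs ys; exact: M_vanishes.
Qed.

Lemma extension_unital : unital_pseudo_isotopy_mod G E1 M truncated e.
Proof.
move=> t t01; split; first exact: M_unit.
by move=> b Gb bE xs ys; exact: truncated_vanishes.
Qed.

End Unital.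

End Extension.

Theorem theorem8p1 (R : realType) (G : set (R * int))
    (C : gradedSpace R) (n : int) (pair : C -> C -> R) (E0 E1 : R)
    (m0 m1 : operations C) (mt ct : R -> operations C)
    (hG : discrete_submonoid G) (hE : E0 < E1)
    (hm0 : cyclic_Ainfty_mod G n pair E0 m0)
    (hm1 : cyclic_Ainfty_mod G n pair E1 m1)
    (hpi : pseudo_isotopy_mod G n pair E0 mt ct)
    (hjoin : joins_mod G E0 mt m0 m1) :
  (exists m0' : operations C,
     [/\ extends_mod G E0 m0 m0',
         cyclic_Ainfty_mod G n pair E1 m0' &
         exists mt' ct' : R -> operations C,
           [/\ forall t, t \in `[0, 1] ->
                 extends_mod G E0 (mt t) (mt' t) /\
                 extends_mod G E0 (ct t) (ct' t),
               pseudo_isotopy_mod G n pair E1 mt' ct' &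
               joins_mod G E1 mt' m0' m1]])
  /\
  (forall e : C,
     is_unit_mod G E0 m0 e -> is_unit_mod G E1 m1 e ->
     unital_pseudo_isotopy_mod G E0 mt ct e ->
     exists m0' : operations C,
     [/\ extends_mod G E0 m0 m0',
         cyclic_Ainfty_mod G n pair E1 m0',
         is_unit_mod G E1 m0' e &
         exists mt' ct' : R -> operations C,
           [/\ forall t, t \in `[0, 1] ->
                 extends_mod G E0 (mt t) (mt' t) /\
                 extends_mod G E0 (ct t) (ct' t),
               pseudo_isotopy_mod G n pair E1 mt' ct',
               joins_mod G E1 mt' m0' m1 &
               unital_pseudo_isotopy_mod G E1 mt' ct' e]]).
Proof.
have [tau [tau_lin tauE]] := parity_involution_exists C.
have [M ME] := extension_exists G E0 m1 mt ct tau.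
have hM0 := extension_extends0 hjoin ME.
have hA := M_Ainfty hG hm0 hm1 hpi hjoin tau_lin tauE ME.
have hP := extension_pseudo_isotopy hG hm0 hm1 hpi hjoin tau_lin tauE ME.
have hJ := extension_joins hG hm1 hpi hjoin tau_lin tauE ME.
have hX := extension_extends ME.
(* The extension of m^0 is the initial value of the extended path. *)
split=> [|e _ he1 hu]; exists (M 0); split=> //; try exact: hA (in01_0 R).
- by exists M, (truncated E0 ct); split=> // t _; exact: hX.
- exact: (M_unit hG hm1 hpi hjoin tau_lin tauE ME he1 hu (in01_0 R)).
- exists M, (truncated E0 ct); split.
  + by move=> t _; exact: hX.
  + exact: hP.
  + exact: hJ.
  + exact: (extension_unital hG hm1 hpi hjoin tau_lin tauE ME he1 hu).
Qed.
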